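(* Let $\mu$ be a non-atomic self-similar measure with respect to a self-similar IFS $\{\varphi_i(x)=s_i x+t_i\}_{i=1}^n$ (with a strictly positive probability vector), and let $\beta>1$. Then there exists a non-trivial Bernoulli model $\Sigma=((\Phi^{(i)})_{i\in I},(\mathbf{p}_i)_{i\in I},\mathbb{P})$ satisfying the strong separation condition such that: (1) $\mu=\int \eta^{(\omega)}\,d\mathbb{P}(\omega)$; (2) if $\frac{\log|s_j|}{\log\beta}\notin\mathbb{Q}$ for some $j$, then there exists $i\in I$ such that $\frac{\log|r_i|}{\log\beta}\notin\mathbb{Q}$, where $r_i$ is the common contraction ratio of the IFS $\Phi^{(i)}$.
   Context: A self-similar IFS is a finite family of maps $\varphi_i(x)=s_i x+t_i$, $s_i\in(-1,1)\setminus\{0\}$, mapping some compact interval into itself, with at least two of the maps having distinct fixed points; the self-similar measure for a strictly positive probability vector $\mathbf{p}$ is the unique Borel probability measure $\mu$ with $\mu=\sum_i p_i\,\varphi_i\mu$. A model is defined as follows. Let $I$ be a finite set and for each $i\in I$ let $\Phi^{(i)}=(f^{(i)}_1,\dots,f^{(i)}_{k_i})$ be a homogeneous IFS: there is $r_i\in(-1,0)\cup(0,1)$ with $f^{(i)}_j(x)=r_i x+t^{(i)}_j$, $t^{(i)}_j\in\mathbb{R}$ ($k_i=1$ is allowed). Let $\Omega=I^{\mathbb{N}}$ with left shift $\sigma$. For $\omega\in\Omega$ let $X^{(\omega)}_\infty=\prod_{j\ge1}\{1,\dots,k_{\omega_j}\}$, and define the coding map $\Pi_\omega(u)=\sum_{n\ge1}\big(\prod_{j=1}^{n-1}r_{\omega_j}\big)t^{(\omega_n)}_{u_n}$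 for $u\in X^{(\omega)}_\infty$, with image $Y^{(\omega)}$. Then $Y^{(\omega)}=\bigcup_{u=1}^{k_{\omega_1}} f^{(\omega_1)}_u(Y^{(\sigma\omega)})$; the model satisfies the strong separation condition if this union is disjoint for every $\omega\in\Omega$ (a union of a single set counts as disjoint). For each $i\in I$ let $\mathbf{p}_i=(p^{(i)}_1,\dots,p^{(i)}_{k_i})$ be a strictly positive probability vector; $\bar\eta^{(\omega)}=\prod_n\mathbf{p}_{\omega_n}$ on $X^{(\omega)}_\infty$, and $\eta^{(\omega)}=\Pi_\omega\bar\eta^{(\omega)}$. Let $\mathbb{P}$ be a $\sigma$-invariant probability measure on $\Omega$. The triple $\Sigma=((\Phi^{(i)})_{i\in I},(\mathbf{p}_i)_{i\in I},\mathbb{P})$ is a model; it is Bernoulli if $\mathbb{P}$ is a Bernoulli measure on $\Omega$, and non-trivial if $\eta^{(\omega)}$ is non-atomic for $\mathbb{P}$-a.e. $\omega$. *)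

(* Defs.v *)
From HB Require Import structures.
From mathcomp Require Import all_boot all_order all_algebra.
From mathcomp Require Import all_classical all_reals all_analysis.
Unset Printing Implicit Defensive.
Import Order.TTheory GRing.Theory Num.Theory.
Local Open Scope classical_set_scope.
Local Open Scope ring_scope.

Definition ifs_map (R : realType) n (s t : 'I_n -> R) (i : 'I_n) (x : R) : R :=
  s i * x + t i.
Arguments ifs_map {R n}.

Definition self_similar_IFS (R : realType) n (s t : 'I_n -> R) : Prop :=
  (forall i, s i != 0 /\ `|s i| < 1) /\
  (exists a b : R, a <= b /\
     forall i x, a <= x <= b -> a <= ifs_map s t i x <= b) /\
  (exists i j (x y : R),
     ifs_map s t i x = x /\ ifs_map s t j y = y /\ x != y).
Arguments self_similar_IFS {R n}.

Definition prob_vector (R : realType) (T : finType) (p : T -> R) : Prop :=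
  (forall i, 0 <= p i) /\ \sum_(i : T) p i = 1.
Arguments prob_vector {R T}.

Definition pos_prob_vector (R : realType) (T : finType) (p : T -> R) : Prop :=
  (forall i, 0 < p i) /\ \sum_(i : T) p i = 1.
Arguments pos_prob_vector {R T}.

Definition self_similar_measure (R : realType) n (s t p : 'I_n -> R)
  (mu : probability R R) : Prop :=
  forall A : set R, measurable A ->
    mu A = (\sum_(i < n) (p i)%:E * mu (ifs_map s t i @^-1` A))%E.
Arguments self_similar_measure {R n}.

Definition non_atomic (R : realType) d (T : measurableType d)
  (nu : set T -> \bar R) : Prop :=
  forall x : T, nu [set x] = 0%E.
Arguments non_atomic {R d T}.

Definition seqI (m : nat) := nat -> 'I_m.+1.
HB.instance Definition _ (m : nat) := gen_eqMixin (seqI m).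
HB.instance Definition _ (m : nat) := gen_choiceMixin (seqI m).
HB.instance Definition _ (m : nat) := isPointed.Build (seqI m) (fun _ => ord0).

(* cylinder sets { w | w n = a } generate the product sigma-algebra *)
Definition cylI (m : nat) : set (set (seqI m)) :=
  [set A | exists (n : nat) (a : 'I_m.+1), A = [set w : seqI m | w n = a]].

Definition Omega (m : nat) := g_sigma_algebraType (cylI m).

Definition shift (m : nat) (w : Omega m) : Omega m := fun n => w n.+1.
Arguments shift {m}.

Definition shift_invariant (R : realType) m (P : probability (Omega m) R) :=
  forall A : set (Omega m), measurable A -> P (shift @^-1` A) = P A.
Arguments shift_invariant {R m}.

Definition bernoulli_measure (R : realType) m (P : probability (Omega m) R) :=
  exists q : 'I_m.+1 -> R, prob_vector q /\
    forall (N : nat) (w : Omega m),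
      P [set v : Omega m | forall j, (j < N)%N -> v j = w j] =
      (\prod_(j < N) q (w j))%:E.
Arguments bernoulli_measure {R m}.

(* K n is (number of digits at level n) - 1, so the level-n alphabet is 'I_(K n).+1 *)
Definition dseq (K : nat -> nat) := forall n : nat, 'I_(K n).+1.
HB.instance Definition _ (K : nat -> nat) := gen_eqMixin (dseq K).
HB.instance Definition _ (K : nat -> nat) := gen_choiceMixin (dseq K).
HB.instance Definition _ (K : nat -> nat) := isPointed.Build (dseq K) (fun n => ord0).

Definition cylD (K : nat -> nat) : set (set (dseq K)) :=
  [set A | exists (n : nat) (a : 'I_(K n).+1), A = [set u : dseq K | u n = a]].

Definition Xinf (K : nat -> nat) := g_sigma_algebraType (cylD K).

Definition is_product_measure (R : realType) (K : nat -> nat)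
  (q : forall n, 'I_(K n).+1 -> R) (Q : probability (Xinf K) R) : Prop :=
  forall (N : nat) (w : Xinf K),
    Q [set u : Xinf K | forall j, (j < N)%N -> u j = w j] =
    (\prod_(j < N) q j (w j))%:E.
Arguments is_product_measure {R K}.

(* I = 'I_m.+1; Phi^(i) = (x |-> r i * x + t i u)_{u : 'I_(k i).+1}. *)

Definition digits m (k : 'I_m.+1 -> nat) (w : Omega m) : nat -> nat :=
  fun n => k (w n).
Arguments digits {m}.

Definition coding (R : realType) m (k : 'I_m.+1 -> nat) (r : 'I_m.+1 -> R)
  (t : forall i : 'I_m.+1, 'I_(k i).+1 -> R) (w : Omega m)
  (u : Xinf (digits k w)) : R :=
  limn (fun N : nat => \sum_(n < N) ((\prod_(j < n) r (w j)) * t (w n) (u n))).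
Arguments coding {R m k} r t w.

Definition Yset (R : realType) m (k : 'I_m.+1 -> nat) (r : 'I_m.+1 -> R)
  (t : forall i : 'I_m.+1, 'I_(k i).+1 -> R) (w : Omega m) : set R :=
  range (coding r t w).
Arguments Yset {R m k}.

Definition model_map (R : realType) m (k : 'I_m.+1 -> nat) (r : 'I_m.+1 -> R)
  (t : forall i : 'I_m.+1, 'I_(k i).+1 -> R) (i : 'I_m.+1) (u : 'I_(k i).+1)
  (x : R) : R := r i * x + t i u.
Arguments model_map {R m k}.

(* strong separation: Y^(w) = U_u f^(w_0)_u (Y^(shift w)) is a disjoint union *)
Definition strong_separation (R : realType) m (k : 'I_m.+1 -> nat)
  (r : 'I_m.+1 -> R) (t : forall i : 'I_m.+1, 'I_(k i).+1 -> R) : Prop :=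
  forall (w : Omega m) (u v : 'I_(k (w 0%N)).+1), u != v ->
    (model_map r t (w 0%N) u @` Yset r t (shift w)) `&`
    (model_map r t (w 0%N) v @` Yset r t (shift w)) = set0.
Arguments strong_separation {R m k}.

Definition eta_meas (R : realType) m (k : 'I_m.+1 -> nat) (r : 'I_m.+1 -> R)
  (t : forall i : 'I_m.+1, 'I_(k i).+1 -> R) (w : Omega m)
  (Q : probability (Xinf (digits k w)) R) : set R -> \bar R :=
  fun A => Q (coding r t w @^-1` A).
Arguments eta_meas {R m k} r t w.

(* Main.v *)
(** Let [x], [y] be distinct fixed points of the maps [i], [j]. For large [N] the
    words [a = i^N j^N] and [b = j^N i^N] of length [2N] have the same
    contraction ratio, while their maps send a large interval close to [x],
    respectively [y], hence have disjoint images. Merge [a] and [b] into one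
    letter carrying a two-map homogeneous IFS and let every other word of length
    [2N] be a letter carrying a single map; choose letters independently, with
    the total weight of their words. Strong separation only has to be checked
    for the merged letter. Expanding [L] levels of the self-similarity relation
    of [mu] and of the [eta^(w)] gives the same discrete measures up to an error
    that tends to 0 with [L], which identifies both distribution functions. Strong
    separation makes the coding injective, and the merged letter has positive
    probability, so that almost surely the weights of cylinders tend to 0 and
    [eta^(w)] has no atoms. The words [l^(2N)] are not merged, so irrationality
    of [log |s_l| / log beta] is inherited. *)

Require Import Defs.
From HB Require Import structures.
From mathcomp Require Import all_boot all_order all_algebra.
From mathcomp Require Import all_classical all_reals all_analysis.
From mathcomp Require Import measurable_realfun.
From mathcomp Require Import ring lra.
Import Order.TTheory GRing.Theory Num.Theory.
Import numFieldNormedType.Exports.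
Local Open Scope classical_set_scope.
Local Open Scope ring_scope.

Set Implicit Arguments.
Unset Strict Implicit.

(** * Functions of finitely many digits and their expectations *)

Definition dcons (K : nat -> nat) (a : 'I_(K 0%N).+1)
    (v : forall n, 'I_(K n.+1).+1) : forall n, 'I_(K n).+1 :=
  fun n => match n with 0%N => a | n'.+1 => v n' end.
Arguments dcons {K}.

(** Stands for measurability with respect to the first [N] digits; the alphabet may change from
    digit to digit. *)
Definition prefix_dep (K : nat -> nat) (V : Type) (N : nat)
    (h : (forall n, 'I_(K n).+1) -> V) : Prop :=
  forall u v, (forall j, (j < N)%N -> u j = v j) -> h u = h v.
Arguments prefix_dep {K V}.

Lemma prefix_dep_dcons (K : nat -> nat) (V : Type) (N : nat)
    (h : (forall n, 'I_(K n).+1) -> V) a :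
  prefix_dep N.+1 h -> prefix_dep N (fun v => h (dcons a v)).
Proof. by move=> hN u v uv; apply: hN => -[//|j] /= jN; exact: uv. Qed.

(** For [h] depending on [N] digits this finite sum is the integral of [h] against the product of
    the vectors [q n]. Recursion on the first digit matches one step of a self-similarity relation.
    The tail [fun=> ord0] is a dummy, invisible to such [h]. *)
Fixpoint expect (R : realType) (N : nat) (K : nat -> nat)
    (q : forall n, 'I_(K n).+1 -> R) (h : (forall n, 'I_(K n).+1) -> R) : R :=
  match N with
  | 0%N => h (fun=> ord0)
  | N'.+1 => \sum_(a < (K 0%N).+1) q 0%N a *
      @expect R N' (fun n => K n.+1) (fun n => q n.+1) (fun v => h (dcons a v))
  end.
Arguments expect {R} N {K} q h.

Section process.
Context {d} {T : measurableType d} {R : realType} (P : {measure set T -> \bar R}).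

(** Fixing the first digit leaves a condition on one digit fewer; [D] accumulates the conditions on
    digits already fixed. *)
Lemma prefix_measurable (N : nat) (K : nat -> nat) (X : forall n, T -> 'I_(K n).+1)
    (H : (forall n, 'I_(K n).+1) -> Prop) (D : set T) :
  (forall n a, measurable [set x | X n x = a]) -> measurable D ->
  prefix_dep N H -> measurable (D `&` [set x | H (fun n => X n x)]).
Proof.
elim: N K X H D => [|N IH] K X H D mX mD HN.
  have [H0|H0] := pselect (H (fun=> ord0)).
    rewrite (_ : _ `&` _ = D)//; apply/seteqP; split => [x []//|x Dx]; split=> //=.
    by rewrite (HN _ (fun=> ord0)).
  rewrite (_ : _ `&` _ = set0)//; apply/seteqP; split => // x [Dx /=].
  by rewrite (HN _ (fun=> ord0)).
rewrite (_ : _ `&` _ = \bigcup_(a in [set: 'I_(K 0%N).+1])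
    ((D `&` [set x | X 0%N x = a]) `&`
      [set x | H (dcons a (fun n => X n.+1 x))])).
  apply: fin_bigcup_measurable; first exact: finite_finset.
  move=> a _; apply: (IH (fun n => K n.+1) (fun n => X n.+1)
      (fun v => H (dcons a v))) => //; first exact: measurableI.
  exact: prefix_dep_dcons.
have E x : H (fun n => X n x) = H (dcons (X 0%N x) (fun n => X n.+1 x)).
  by apply: HN => -[].
apply/seteqP; split=> x /=.
  by move=> [Dx]; rewrite E => Hx; exists (X 0%N x).
by move=> [a _ [[Dx <-]]]; rewrite E.
Qed.

Lemma prefix_measurable_fun (N : nat) (K : nat -> nat) (X : forall n, T -> 'I_(K n).+1)
    d' (V : measurableType d') (h : (forall n, 'I_(K n).+1) -> V) :
  (forall n a, measurable [set x | X n x = a]) ->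
  prefix_dep N h -> measurable_fun setT (fun x => h (fun n => X n x)).
Proof.
move=> mX hN _ B mB.
apply: (prefix_measurable (N := N) (X := X) (H := fun v => B (h v))) => //.
by move=> u v /hN ->.
Qed.

(* [D] is the event that the digits already read take given values; reading
   one more digit refines [D] and multiplies [c]. *)
Lemma integral_prefix (N : nat) (K : nat -> nat) (q : forall n, 'I_(K n).+1 -> R)
    (X : forall n, T -> 'I_(K n).+1) (h : (forall n, 'I_(K n).+1) -> R)
    (D : set T) (c : R) :
  (forall n a, measurable [set x | X n x = a]) -> measurable D ->
  (forall n (v : forall n, 'I_(K n).+1),
    P (D `&` [set x | forall j, (j < n)%N -> X j x = v j]) =
    (c * \prod_(j < n) q j (v j))%:E) ->
  prefix_dep N h -> (forall v, 0 <= h v) ->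
  (\int[P]_(x in D) (h (fun n => X n x))%:E = (c * expect N q h)%:E)%E.
Proof.
elim: N K q X h D c => [|N IH] K q X h D c mX mD PD hN h0.
  rewrite (eq_integral (fun=> (h (fun=> ord0))%:E)); last first.
    by move=> x _; congr (_ %:E); apply: hN.
  rewrite integral_cst//= mulrC EFinM; congr (_ * _)%E.
  have := PD 0%N (fun=> ord0); rewrite big_ord0 mulr1 => <-.
  by congr (P _); apply/seteqP; split=> // x [].
have DE : D = \big[setU/set0]_(a <- enum 'I_(K 0%N).+1) (D `&` [set x | X 0%N x = a]).
  rewrite -bigcup_seq; apply/seteqP; split=> x; last by move=> [a _ []].
  by move=> Dx; exists (X 0%N x) => //=; rewrite mem_enum.
have mDa a : measurable (D `&` [set x | X 0%N x = a]) by exact: measurableI.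
rewrite {1}DE ge0_integral_bigsetU//=; last 4 first.
- exact: enum_uniq.
- by move=> a b _ _ [x [[_ /= <-] [_ /= <-]]].
- rewrite -DE; apply/measurable_EFinP/measurable_funTS.
  exact: (prefix_measurable_fun (N := N.+1)).
- by move=> x _; rewrite lee_fin.
rewrite big_enum/= mulr_sumr -sumEFin; apply: eq_bigr => a _.
rewrite (eq_integral (fun x => (h (dcons a (fun n => X n.+1 x)))%:E)); last first.
  by move=> x; rewrite inE => -[_ /= <-]; congr (_ %:E); apply: hN => -[].
rewrite (IH (fun n => K n.+1) (fun n => q n.+1) (fun n => X n.+1)
  (fun v => h (dcons a v)) _ (c * q 0%N a)) ?mulrA//.
- move=> n v; rewrite -mulrA.
  have := PD n.+1 (dcons a v); rewrite big_ord_recl/= => <-.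
  congr (P _); rewrite -setIA; congr (D `&` _).
  apply/seteqP; split=> x /=; first by move=> [xa xv] [|j] /= ?; [exact: xa|exact: xv].
  by move=> xv; split=> [|j jn]; [exact: (xv 0%N)|exact: (xv j.+1)].
- exact: prefix_dep_dcons.
Qed.
End process.

(** * The coding map and its partial sums *)

Section coding.
Context {R : realType} {m : nat} {k : 'I_m.+1 -> nat}.
Variables (r : 'I_m.+1 -> R) (t : forall i : 'I_m.+1, 'I_(k i).+1 -> R).

Definition partial_coding (w : nat -> 'I_m.+1) (u : forall n, 'I_(k (w n)).+1)
    (N : nat) : R :=
  \sum_(n < N) ((\prod_(j < n) r (w j)) * t (u n)).

(** The first letter gives the outermost map; this recursion drives the inductions on the level. *)
Lemma partial_codingS w u N : partial_coding (w := w) u N.+1 =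
  r (w 0%N) * partial_coding (w := fun n => w n.+1) (fun n => u n.+1) N + t (u 0%N).
Proof.
rewrite /partial_coding big_ord_recl big_ord0 mul1r addrC; congr (_ + _).
rewrite mulr_sumr; apply: eq_bigr => n _.
by rewrite big_ord_recl mulrA.
Qed.

Variables (rho M : R).
Hypotheses (rho0 : 0 <= rho) (rho1 : rho < 1) (M0 : 0 <= M).
Hypothesis r_rho : forall i, `|r i| <= rho.
Hypothesis rtM : forall i u, `|r i| * M + `|t (i := i) u| <= M.

(** The hypothesis [rtM] says that each map sends [[-M, M]] into itself. *)
Lemma model_map_bounded i (u : 'I_(k i).+1) x :
  `|x| <= M -> `|model_map r t i u x| <= M.
Proof.
move=> xM; rewrite (le_trans (ler_normD _ _))// normrM (le_trans _ (rtM u))//.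
by rewrite lerD2r ler_wpM2l.
Qed.

Lemma model_map_dist i (u : 'I_(k i).+1) x y :
  `|model_map r t i u x - model_map r t i u y| <= rho * `|x - y|.
Proof.
rewrite /model_map opprD addrACA subrr addr0 -mulrBr normrM.
by rewrite ler_wpM2r.
Qed.

Lemma partial_coding_bounded w u N : `|partial_coding (w := w) u N| <= M.
Proof.
elim: N w u => [|N IH] w u; first by rewrite /partial_coding big_ord0 normr0.
by rewrite partial_codingS; exact: model_map_bounded.
Qed.

(** Both sums apply the same first [N] maps, contracting by at most [rho ^+ N], to two points of
    [[-M, M]]. *)
Lemma partial_coding_dist w u N n :
  `|partial_coding (w := w) u (N + n) - partial_coding u N| <= M *+ 2 * rho ^+ N.
Proof.
elim: N w u => [|N IH] w u.
  rewrite expr0 mulr1 (le_trans (ler_normB _ _))// mulr2n.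
  by apply: lerD; exact: partial_coding_bounded.
rewrite addSn !partial_codingS (le_trans (model_map_dist _ _ _))//.
by rewrite exprS mulrCA ler_wpM2l.
Qed.

Lemma radius_cvg0 : (M *+ 2 * rho ^+ N) @[N --> \oo] --> (0 : R).
Proof.
rewrite -[X in _ --> X](mulr0 (M *+ 2)); apply: cvgMr.
by apply: cvg_expr; rewrite ger0_norm.
Qed.

Lemma partial_coding_cvg w u : cvgn (partial_coding (w := w) u).
Proof.
apply: R_complete; apply: cauchy_exP => e e0.
have [N _ HN] : \forall N \near \oo, M *+ 2 * rho ^+ N < e.
  exact: (cvgr_lt _ radius_cvg0).
exists (partial_coding u N); exists N => //= n /= Nn.
rewrite -ball_normE/= distrC -(subnKC Nn).
exact: le_lt_trans (partial_coding_dist _ _ _) (HN _ (leqnn N)).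
Qed.

Lemma coding_dist (w : Omega m) (u : Xinf (digits k w)) N :
  `|coding r t w u - partial_coding u N| <= M *+ 2 * rho ^+ N.
Proof.
have cv : `|partial_coding u n - partial_coding u N| @[n --> \oo] -->
    `|coding r t w u - partial_coding u N|.
  apply: cvg_norm; apply: cvgB; last exact: cvg_cst.
  exact: partial_coding_cvg.
rewrite -(cvg_lim _ cv)//; apply: limr_le; first by apply/cvg_ex; eexists; exact: cv.
by exists N => //= n /= Nn; rewrite -(subnKC Nn); exact: partial_coding_dist.
Qed.

Lemma coding_bounded (w : Omega m) (u : Xinf (digits k w)) : `|coding r t w u| <= M.
Proof.
have cv : `|partial_coding u n| @[n --> \oo] --> `|coding r t w u|.
  by apply: cvg_norm; exact: partial_coding_cvg.
rewrite -(cvg_lim _ cv)//; apply: limr_le; first by apply/cvg_ex; eexists; exact: cv.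
by near=> n; exact: partial_coding_bounded.
Unshelve. all: by end_near. Qed.

Lemma coding_shift (w : Omega m) (u : Xinf (digits k w)) :
  coding r t w u = model_map r t (w 0%N) (u 0%N)
    (coding r t (Defs.shift w) (fun n => u n.+1)).
Proof.
have cv : partial_coding u n @[n --> \oo] --> coding r t w u.
  exact: partial_coding_cvg.
rewrite -(cvg_lim _ cv)//; apply/cvg_lim => //.
rewrite -(cvg_shiftS (partial_coding u))/=.
under eq_fun do rewrite partial_codingS.
apply: cvgD; last exact: cvg_cst.
by apply: cvgMr; exact: partial_coding_cvg.
Qed.

(** Every [Yset] lies in [[-M, M]], so it suffices to separate the images of that interval. *)
Lemma strong_separation_bounded :
  (forall i (u v : 'I_(k i).+1) x y, u != v -> `|x| <= M -> `|y| <= M ->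
    model_map r t i u x <> model_map r t i v y) ->
  strong_separation r t.
Proof.
move=> sep w u v uv; apply/seteqP; split=> // z [[_ [x _ <-] <-] [_ [y _ <-]]].
move=> /esym; apply: sep uv _ _; exact: coding_bounded.
Qed.

(** Separation recovers the first digit from the point. The first map is injective because its ratio
    is nonzero, so it can be cancelled and the argument repeated on the shifted sequences. *)
Lemma coding_inj (w : Omega m) (u v : Xinf (digits k w)) :
  (forall i, r i != 0) -> strong_separation r t ->
  coding r t w u = coding r t w v -> u = v.
Proof.
move=> r0 ssc uv; apply: functional_extensionality_dep => n.
have step (w' : Omega m) (u' v' : Xinf (digits k w')) :
    coding r t w' u' = coding r t w' v' -> u' 0%N = v' 0%N /\
    coding r t (Defs.shift w') (fun n => u' n.+1) =
    coding r t (Defs.shift w') (fun n => v' n.+1).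
  move=> E; have uv0 : u' 0%N = v' 0%N.
    apply/eqP/negP => /negP /(ssc w'); apply/eqP/set0P.
    exists (coding r t w' u'); split; [|rewrite E]; rewrite coding_shift.
      by eexists; [eexists|].
    by eexists; [eexists|].
  split=> //; move: E; rewrite (coding_shift u') (coding_shift v') uv0 => /addIr.
  exact: mulfI.
elim: n w u v uv => [|n IH] w u v /step[uv0 uv]; first exact: uv0.
exact: (IH (Defs.shift w) (fun n => u n.+1) (fun n => v n.+1)).
Qed.
End coding.

(** * Discrete approximations of [mu] and of the fibre measures *)

Lemma expect_sum (R : realType) (I : finType) (c : I -> R) (N : nat) (K : nat -> nat)
    (q : forall n, 'I_(K n).+1 -> R) (h : I -> (forall n, 'I_(K n).+1) -> R) :
  expect N q (fun v => \sum_i c i * h i v) = \sum_i c i * expect N q (h i).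
Proof.
elim: N K q h => [//|N IH] K q h /=.
under eq_bigr do rewrite IH mulr_sumr.
rewrite exchange_big/=; apply: eq_bigr => i _.
by rewrite mulr_sumr; apply: eq_bigr => a _; rewrite mulrCA.
Qed.

Section level.
Context {R : realType} {m : nat} {k : 'I_m.+1 -> nat}.
Variables (r : 'I_m.+1 -> R) (t : forall i : 'I_m.+1, 'I_(k i).+1 -> R).
Variables (q : 'I_m.+1 -> R) (pp : forall i : 'I_m.+1, 'I_(k i).+1 -> R).

(** The law of the [N]-term partial sum: [N] steps of the self-similarity of the fibre measures,
    started from the point mass at 0. *)
Definition level_eta (w : nat -> 'I_m.+1) (N : nat) (A : set R) : R :=
  expect N (fun n => @pp (w n)) (fun u => \1_A (partial_coding r t u N)).

Definition level_mu (N : nat) (A : set R) : R :=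
  expect N (fun=> q) (fun w => level_eta w N A).

Lemma level_etaS w N A : level_eta w N.+1 A =
  \sum_u pp u * level_eta (fun n => w n.+1) N (model_map r t (w 0%N) u @^-1` A).
Proof.
rewrite /level_eta /=; apply: eq_bigr => u _; congr (_ * expect _ _ _).
by apply/funext => v; rewrite partial_codingS !indicE.
Qed.

(** Drawing a letter and then a digit is one step with weights [q i * pp u], the weights of
    [mu_selfsim]. Hence [level_mu] is also what [N] steps of the relation for [mu] make of the point
    mass at 0. *)
Lemma level_muS N A : level_mu N.+1 A =
  \sum_i q i * \sum_(u < (k i).+1) pp u * level_mu N (model_map r t i u @^-1` A).
Proof.
rewrite /level_mu /=; apply: eq_bigr => i _; congr (_ * _).
rewrite -expect_sum; congr expect; apply/funext => w.
exact: level_etaS.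
Qed.

Lemma level_eta_prefix N A : prefix_dep N (fun w => level_eta w N A).
Proof.
elim: N A => [|N IH] A u v uv; first by rewrite /level_eta/= /partial_coding !big_ord0.
(* The type of the digit [x] depends on the letter [u 0], so the later letters are changed first and
   the first one last. *)
rewrite !level_etaS; transitivity (\sum_(x < (k (u 0%N)).+1)
    pp x * level_eta (fun n => v n.+1) N (model_map r t (u 0%N) x @^-1` A)).
  by apply: eq_bigr => x _; congr (_ * _); apply: IH => j jN; exact: (uv j.+1).
by rewrite (uv 0%N).
Qed.

Hypotheses (q0 : forall i, 0 <= q i) (pp0 : forall i u, 0 <= @pp i u).

Lemma level_eta_ge0 w N A : 0 <= level_eta w N A.
Proof.
elim: N w A => [|N IH] w A; first by rewrite /level_eta/= indicE ler0n.
by rewrite level_etaS; apply: sumr_ge0 => u _; exact: mulr_ge0.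
Qed.

Hypothesis pp1 : forall i, \sum_u @pp i u = 1.

Lemma level_eta_le1 w N A : level_eta w N A <= 1.
Proof.
elim: N w A => [|N IH] w A.
  by rewrite /level_eta/= indicE; case: (_ \in _); rewrite ?ler01.
rewrite level_etaS -(pp1 (w 0%N)); apply: ler_sum => u _.
by rewrite -[leRHS]mulr1 ler_wpM2l.
Qed.

Variables (rho M : R).
Hypotheses (rho0 : 0 <= rho) (M0 : 0 <= M).
Hypothesis r_rho : forall i, `|r i| <= rho.
Hypothesis rtM : forall i u, `|r i| * M + `|t (i := i) u| <= M.
Variable mu : probability R R.
Hypothesis q1 : \sum_i q i = 1.
Hypothesis mu_selfsim : forall A, measurable A ->
  mu A = (\sum_i \sum_(u < (k i).+1) (q i * pp u)%:E *
    mu (model_map r t i u @^-1` A))%E.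

Lemma measurable_preimage_model_map i (u : 'I_(k i).+1) (A : set R) :
  measurable A -> measurable (model_map r t i u @^-1` A).
Proof.
move=> mA; rewrite -[X in measurable X]setTI.
have : measurable_fun setT (model_map r t i u).
  by apply: measurable_funD => //; apply: measurable_funM.
by apply.
Qed.

Lemma measurable_norm_le (c : R) : measurable [set x : R | `|x| <= c].
Proof.
rewrite (_ : mkset _ = `[- c, c]%classic)//.
by apply/seteqP; split=> x /=; rewrite in_itv/= ler_norml.
Qed.

(** The weights [q i * pp u] sum to 1, so a lower bound common to all the [B i u] survives
    averaging. *)
Lemma selfsim_ge A (c : R) (B : forall i, 'I_(k i).+1 -> set R) : measurable A ->
  (forall i u, measurable (B i u)) ->
  (forall i u, (c%:E <= mu (B i u))%E) ->
  (forall i u x, B i u x -> A (model_map r t i u x)) -> (c%:E <= mu A)%E.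
Proof.
move=> mA mB cB BA; rewrite (mu_selfsim mA).
rewrite (_ : c = \sum_i \sum_(u < (k i).+1) (q i * pp u) * c); last first.
  rewrite -[LHS]mul1r -q1 mulr_suml; apply: eq_bigr => i _.
  by rewrite -mulr_suml -mulr_sumr pp1 mulr1.
rewrite -sumEFin; apply: lee_sum => i _; rewrite -sumEFin; apply: lee_sum => u _.
rewrite EFinM lee_wpmul2l ?lee_fin ?mulr_ge0// (le_trans (cB i u))//.
apply: le_measure; rewrite ?inE//; first exact: measurable_preimage_model_map.
by move=> x /BA.
Qed.

(** Every map sends the ball of radius [M + z] into the ball of radius [M + rho * z], so the mass
    [g z] is at most [g (rho ^+ n * z)]. As [g z] tends to 1 when [z] grows, [g y] is 1 for each
    [y > 0]. *)
Lemma selfsim_concentrated (y : R) : rho < 1 -> 0 < y ->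
  mu [set x | `|x| <= M + y] = 1%E.
Proof.
move=> rho1 y0.
pose g z := mu [set x : R | `|x| <= M + z].
have gfin z : g z \is a fin_num by apply: fin_num_measure; exact: measurable_norm_le.
have gmono z z' : z <= z' -> (g z <= g z')%E.
  move=> zz'; apply: le_measure; rewrite ?inE; [exact: measurable_norm_le..|].
  by move=> x /= /le_trans; apply; rewrite lerD2l.
have gstep z : 0 <= z -> (g z <= g (rho * z)%R)%E.
  move=> z0; rewrite -(fineK (gfin z)).
  apply: (@selfsim_ge _ _ (fun _ _ => [set x : R | `|x| <= M + z])).
  - exact: measurable_norm_le.
  - by move=> *; exact: measurable_norm_le.
  - by move=> i u; rewrite fineK.
  - move=> i u x /= xM; rewrite (le_trans (ler_normD _ _))// normrM.
    rewrite (@le_trans _ _ (`|r i| * (M + z) + `|t u|))//.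
      by rewrite lerD2r ler_wpM2l.
    have rz : `|r i| * z <= rho * z by rewrite ler_wpM2r.
    by have rM := rtM u; lra.
have gpow z n : 0 <= z -> (g z <= g (rho ^+ n * z)%R)%E.
  move=> z0; elim: n => [|n IH]; first by rewrite expr0 mul1r.
  by rewrite exprS -mulrA (le_trans IH)// gstep// mulr_ge0// exprn_ge0.
apply/eqP; rewrite eq_le probability_le1/=; last exact: measurable_norm_le.
have cv : g n%:R @[n --> \oo] --> mu setT.
  rewrite (_ : setT = \bigcup_n [set x : R | `|x| <= M + n%:R]).
    apply: nondecreasing_cvg_mu; first by move=> n; exact: measurable_norm_le.
      by apply: bigcupT_measurable => n; exact: measurable_norm_le.
    move=> a b ab; apply/subsetPset => x /= /le_trans; apply.
    by rewrite lerD2l ler_nat.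
  apply/seteqP; split=> // x _; exists (Num.truncn `|x|).+1 => //=.
  rewrite (@le_trans _ _ ((Num.truncn `|x|).+1%:R))//; last by rewrite lerDr.
  by rewrite ltW// truncnS_gt.
rewrite -(probability_setT mu) -(cvg_lim _ cv)//.
apply: lime_le; first by apply/cvg_ex; eexists; exact: cv.
near=> n.
(* Iterate until the excess radius [n] has shrunk below [y]. *)
have zcv : (rho ^+ j * n%:R) @[j --> \oo] --> (0 : R).
  rewrite -[X in _ --> X](mul0r (n%:R)); apply: cvgMl.
  by apply: cvg_expr; rewrite ger0_norm.
have [N _ HN] : \forall N \near \oo, rho ^+ N * n%:R < y by exact: (cvgr_lt _ zcv).
by apply: (le_trans (gpow _ N _)) => //; apply: gmono; apply: ltW; apply: HN => /=.
Unshelve. all: by end_near. Qed.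

Hypothesis muM : mu [set x | `|x| <= M] = 1%E.

(** Both measures are pulled back along the same maps, which shrink distances by [rho] per level. At
    level 0 the discrete measure is the point mass at 0, and [mu] lives within distance [M] of
    it. *)
Lemma mu_le_level N (A B : set R) : measurable A ->
  (forall x y, A x -> `|x - y| <= M *+ 2 * rho ^+ N -> B y) ->
  (mu A <= (level_mu N B)%:E)%E.
Proof.
elim: N A B => [|N IH] A B mA AB.
  rewrite /level_mu/level_eta/= indicE; have [B0|B0] := boolP (_ \in B).
    exact: probability_le1.
  have mM := measurable_norm_le M.
  have muC : mu (~` [set x | `|x| <= M]) = 0%E.
    by rewrite probability_setC// muM subee.
  (* Since 0 is not in [B], the set [A] avoids [[-M, M]]. *)
  suff -> : mu A = 0%E by [].
  apply: (subset_measure0 mA (measurableC mM) _ muC).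
  move=> x Ax /= xM; move/negP: B0; apply; rewrite inE; apply: AB Ax _.
  rewrite /partial_coding big_ord0 subr0 expr0 mulr1 mulr2n.
  by rewrite (le_trans xM)// lerDl.
rewrite (mu_selfsim mA) level_muS -sumEFin; apply: lee_sum => i _.
rewrite mulr_sumr -sumEFin; apply: lee_sum => u _.
rewrite mulrA [leRHS]EFinM lee_wpmul2l ?lee_fin ?mulr_ge0//; apply: IH.
  exact: measurable_preimage_model_map.
move=> x y /= Ax xy; apply: AB Ax _.
rewrite (le_trans (model_map_dist t r_rho u x y))// exprS mulrCA.
by rewrite ler_wpM2l.
Qed.

Lemma level_le_mu N (A B : set R) : measurable B ->
  (forall x y, A x -> `|x - y| <= M *+ 2 * rho ^+ N -> B y) ->
  ((level_mu N A)%:E <= mu B)%E.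
Proof.
elim: N A B => [|N IH] A B mB AB.
  rewrite /level_mu/level_eta/= indicE; have [A0|A0] := boolP (_ \in A); last first.
    by rewrite measure_ge0.
  rewrite -muM; apply: le_measure; rewrite ?inE//; first exact: measurable_norm_le.
  move=> x /= xM; move: A0; rewrite inE => /AB; apply.
  rewrite /partial_coding big_ord0 sub0r normrN expr0 mulr1 mulr2n.
  by rewrite (le_trans xM)// lerDl.
rewrite (mu_selfsim mB) level_muS -sumEFin; apply: lee_sum => i _.
rewrite mulr_sumr -sumEFin; apply: lee_sum => u _.
rewrite mulrA [leLHS]EFinM lee_wpmul2l ?lee_fin ?mulr_ge0//; apply: IH.
  exact: measurable_preimage_model_map.
move=> x y /= Ax xy; apply: AB Ax _.
rewrite (le_trans (model_map_dist t r_rho u x y))// exprS mulrCA.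
by rewrite ler_wpM2l.
Qed.

End level.

(** * Convergence of distribution functions *)

Lemma measurable_ray {R : realType} (y : R) : measurable [set z : R | z <= y].
Proof. by rewrite -set_itvNyc; exact: measurable_itv. Qed.

(** The errors are one-sided: [a n] lies between the distribution function at [x] and at [x + e n],
    so right-continuity suffices and [x] may be an atom. *)
Lemma cdf_squeeze {d} {T : measurableType d} {R : realType} (P : probability T R)
    (X : T -> R) (x : R) (e : nat -> R) (a : nat -> \bar R) :
  measurable_fun setT X -> e n @[n --> \oo] --> (0 : R) ->
  {homo e : m n / (m <= n)%N >-> n <= m} -> (forall n, 0 <= e n) ->
  (forall n, P [set z | (X z <= x)%R] <= a n)%E ->
  (forall n, a n <= P [set z | (X z <= x + e n)%R])%E ->
  a n @[n --> \oo] --> P [set z | X z <= x].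
Proof.
move=> mX ecv emono e0 la au.
have mle y : measurable [set z | X z <= y].
  rewrite (_ : mkset _ = setT `&` X @^-1` `]-oo, y]%classic); first exact: mX.
  by apply/seteqP; split=> z /=; rewrite in_itv//= => -[].
apply: (@squeeze_cvge _ _ _ _ (fun=> P [set z | X z <= x]) _
    (fun n => P [set z | X z <= x + e n])).
- by apply: nearW => n; rewrite la au.
- exact: cvg_cst.
rewrite [X in _ --> P X](_ : _ = \bigcap_n [set z | X z <= x + e n]).
  apply: nonincreasing_cvg_mu => //.
  - by rewrite -ge0_fin_numE// fin_num_measure.
  - exact: bigcapT_measurable.
  - by move=> m n mn; apply/subsetPset => z /= /le_trans; apply; rewrite lerD2l emono.
apply/seteqP; split=> z /=.
  by move=> zx n _ /=; rewrite (le_trans zx)// lerDl.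
move=> H; rewrite -[leRHS]addr0 -(cvg_lim _ ecv)//.
have cv : x + e n @[n --> \oo] --> x + 0 by apply: cvgD => //; exact: cvg_cst.
rewrite (cvg_lim _ ecv)// -(cvg_lim _ cv)//; apply: limr_ge.
  by apply/cvg_ex; eexists; exact: cv.
by apply: nearW => n; exact: H.
Qed.

Section eta.
Context {R : realType} {m : nat} {k : 'I_m.+1 -> nat}.
Variables (r : 'I_m.+1 -> R) (t : forall i : 'I_m.+1, 'I_(k i).+1 -> R).
Variables (pp : forall i : 'I_m.+1, 'I_(k i).+1 -> R).
Variables (w : Omega m) (Q : probability (Xinf (digits k w)) R).

Lemma measurable_digit n (a : 'I_(digits k w n).+1) :
  measurable [set u : Xinf (digits k w) | u n = a].
Proof. by apply: sub_sigma_algebra; exists n, a. Qed.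

Lemma partial_coding_prefix N :
  prefix_dep N (fun u : Xinf (digits k w) => partial_coding r t u N).
Proof. by move=> u v uv; apply: eq_bigr => j _; rewrite uv. Qed.

Lemma measurable_partial_coding N :
  measurable_fun setT (fun u : Xinf (digits k w) => partial_coding r t u N).
Proof.
exact: (prefix_measurable_fun (X := fun n (u : Xinf (digits k w)) => u n)
  measurable_digit (partial_coding_prefix (N := N))).
Qed.

Hypothesis Qprod : is_product_measure (fun j => @pp (w j)) Q.

Lemma level_etaE N (A : set R) : measurable A ->
  Q [set u | A (partial_coding r t u N)] = (level_eta r t pp w N A)%:E.
Proof.
move=> mA; rewrite -[RHS]mul1e -EFinM.
have := @integral_prefix _ _ _ Q N (digits k w) (fun j => @pp (w j))
  (fun n (u : Xinf (digits k w)) => u n)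
  (fun u => \1_A (partial_coding r t u N)) setT 1 measurable_digit measurableT.
move=> <-.
- rewrite -[X in Q X]setIT -integral_indic//.
  rewrite -[X in measurable X]setTI; exact: measurable_partial_coding.
- by move=> n v; rewrite mul1r setTI; exact: Qprod.
- by move=> u v uv; rewrite (partial_coding_prefix uv).
- by move=> v; rewrite indicE ler0n.
Qed.

Variables (rho M : R).
Hypotheses (rho0 : 0 <= rho) (rho1 : rho < 1) (M0 : 0 <= M).
Hypothesis r_rho : forall i, `|r i| <= rho.
Hypothesis rtM : forall i u, `|r i| * M + `|t (i := i) u| <= M.

Lemma measurable_coding :
  measurable_fun setT (coding r t w : Xinf (digits k w) -> R).
Proof.
apply: (measurable_fun_cvg (h := fun N (u : Xinf (digits k w)) => partial_coding r t u N)).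
  by move=> N; exact: measurable_partial_coding.
by move=> u _; exact: (partial_coding_cvg rho0 rho1 M0 r_rho rtM).
Qed.

Let radius N := M *+ 2 * rho ^+ N.

(** Enlarging the ray by [radius N] makes the level-[N] value dominate the limit, and a second
    [radius N] bounds it from above; hence convergence holds at every [x]. *)
Lemma level_eta_cvg x :
  (level_eta r t pp w N [set y | y <= x + radius N])%:E @[N --> \oo] -->
    eta_meas r t w Q [set y | y <= x].
Proof.
have mpc N y : measurable [set u : Xinf (digits k w) | partial_coding r t u N <= y].
  rewrite (_ : mkset _ = setT `&` (fun u => partial_coding r t u N) @^-1` `]-oo, y]%classic).
    exact: measurable_partial_coding.
  by apply/seteqP; split=> z /=; rewrite in_itv//= => -[].
have mc y : measurable [set u : Xinf (digits k w) | coding r t w u <= y].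
  rewrite (_ : mkset _ = setT `&` (coding r t w) @^-1` `]-oo, y]%classic).
    exact: measurable_coding.
  by apply/seteqP; split=> z /=; rewrite in_itv//= => -[].
have mray := @measurable_ray R.
have near u N := coding_dist rho0 rho1 M0 r_rho rtM (w := w) u N.
apply: (@cdf_squeeze _ _ _ Q (coding r t w) x (fun N => radius N + radius N)).
- exact: measurable_coding.
- rewrite -[X in _ --> X](addr0 0); apply: cvgD; exact: radius_cvg0.
- move=> i j ij; apply: lerD; rewrite ler_wpM2l ?mulrn_wge0//;
    by apply: ler_wiXn2l => //; exact: ltW.
- by move=> n; rewrite addr_ge0// mulr_ge0 ?exprn_ge0 ?mulrn_wge0.
- move=> N; rewrite -level_etaE//; apply: le_measure; rewrite ?inE; [exact: mc|exact: mpc|].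
  move=> u /= ux; have := near u N; rewrite ler_norml /radius => /andP[+ _]; lra.
- move=> N; rewrite -level_etaE//; apply: le_measure; rewrite ?inE; [exact: mpc|exact: mc|].
  move=> u /= ux; have := near u N; rewrite ler_norml /radius => /andP[_ +].
  by move: ux; rewrite /radius /=; lra.
Qed.
End eta.

(** The enlarged rays are those used for the fibre measures, so the two limits can be compared level
    by level. *)
Lemma level_mu_cvg {R : realType} {m : nat} {k : 'I_m.+1 -> nat}
    (r : 'I_m.+1 -> R) (t : forall i : 'I_m.+1, 'I_(k i).+1 -> R)
    (q : 'I_m.+1 -> R) (pp : forall i : 'I_m.+1, 'I_(k i).+1 -> R) (rho M : R)
    (mu : probability R R) (x : R) :
  (forall i, 0 <= q i) -> (forall i u, 0 <= @pp i u) ->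
  0 <= rho -> rho < 1 -> 0 <= M -> (forall i, `|r i| <= rho) ->
  (forall A, measurable A ->
    mu A = (\sum_i \sum_(u < (k i).+1) (q i * pp i u)%:E *
      mu (model_map r t i u @^-1` A))%E) ->
  mu [set x | `|x| <= M] = 1%E ->
  (level_mu r t q pp N [set y | y <= x + M *+ 2 * rho ^+ N])%:E @[N --> \oo] -->
    mu [set y | y <= x].
Proof.
move=> q0 pp0 rho0 rho1 M0 r_rho mu_selfsim muM.
have mray := @measurable_ray R.
pose radius N := M *+ 2 * rho ^+ N.
apply: (@cdf_squeeze _ _ _ mu id x (fun N => radius N + radius N)).
- exact: measurable_id.
- rewrite -[X in _ --> X](addr0 0); apply: cvgD; exact: radius_cvg0.
- move=> i j ij; apply: lerD; rewrite ler_wpM2l ?mulrn_wge0//;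
    by apply: ler_wiXn2l => //; exact: ltW.
- by move=> n; rewrite addr_ge0// mulr_ge0 ?exprn_ge0 ?mulrn_wge0.
- move=> N; apply: (mu_le_level q0 pp0 rho0 M0 r_rho mu_selfsim muM) => //.
  by move=> y z /= yx; rewrite ler_norml => /andP[+ _]; lra.
- move=> N; apply: (level_le_mu q0 pp0 rho0 M0 r_rho mu_selfsim muM) => //.
  by move=> y z /= yx; rewrite ler_norml /radius /= => /andP[+ _]; lra.
Qed.

Lemma measurable_letter {m : nat} (n : nat) (a : 'I_m.+1) :
  measurable [set w : Omega m | w n = a].
Proof. by apply: sub_sigma_algebra; exists n, a. Qed.

Lemma integral_level_eta {R : realType} {m : nat} {k : 'I_m.+1 -> nat}
    (r : 'I_m.+1 -> R) (t : forall i : 'I_m.+1, 'I_(k i).+1 -> R)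
    (q : 'I_m.+1 -> R) (pp : forall i : 'I_m.+1, 'I_(k i).+1 -> R)
    (P : probability (Omega m) R) N (A : set R) :
  (forall N (w : Omega m), P [set v : Omega m | forall j, (j < N)%N -> v j = w j] =
      (\prod_(j < N) q (w j))%:E) ->
  (forall i u, 0 <= pp i u) ->
  (\int[P]_w (level_eta r t pp w N A)%:E = (level_mu r t q pp N A)%:E)%E.
Proof.
move=> Pq pp0; rewrite -[RHS]mul1e -EFinM.
apply: (@integral_prefix _ _ _ P N (fun=> m) (fun=> q)
  (fun n (w : Omega m) => w n) (fun w => level_eta r t pp w N A)) => //.
- by move=> n a; exact: measurable_letter.
- by move=> n v; rewrite mul1r setTI; exact: Pq.
- exact: level_eta_prefix.
- by move=> v; exact: level_eta_ge0.
Qed.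

(** * Disintegration of [mu] over the fibre measures *)

Section disintegration.
Context {R : realType} {m : nat} {k : 'I_m.+1 -> nat}.
Variables (r : 'I_m.+1 -> R) (t : forall i : 'I_m.+1, 'I_(k i).+1 -> R).
Variables (q : 'I_m.+1 -> R) (pp : forall i : 'I_m.+1, 'I_(k i).+1 -> R).
Variables (rho M : R) (mu : probability R R) (P : probability (Omega m) R).
Variable etabar : forall w : Omega m, probability (Xinf (digits k w)) R.
Hypotheses (q0 : forall i, 0 <= q i) (pp0 : forall i u, 0 <= @pp i u).
Hypothesis pp1 : forall i, \sum_u @pp i u = 1.
Hypotheses (rho0 : 0 <= rho) (rho1 : rho < 1) (M0 : 0 <= M).
Hypothesis r_rho : forall i, `|r i| <= rho.
Hypothesis rtM : forall i u, `|r i| * M + `|t (i := i) u| <= M.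
Hypothesis mu_selfsim : forall A, measurable A ->
  mu A = (\sum_i \sum_(u < (k i).+1) (q i * pp u)%:E *
    mu (model_map r t i u @^-1` A))%E.
Hypothesis muM : mu [set x | `|x| <= M] = 1%E.
Hypothesis Pq : forall N (w : Omega m),
  P [set v : Omega m | forall j, (j < N)%N -> v j = w j] =
  (\prod_(j < N) q (w j))%:E.
Hypothesis etabar_prod : forall w : Omega m,
  is_product_measure (fun j => @pp (w j)) (etabar w).

Let eta w A := eta_meas r t w (etabar w) A.

Let measurable_coding_preimage w A : measurable A -> measurable (coding r t w @^-1` A).
Proof.
move=> mA; rewrite -[X in measurable X]setTI.
exact: (measurable_coding rho0 rho1 M0 r_rho rtM).
Qed.

Let measurable_level N A : measurable_fun setT
  (fun w : Omega m => (level_eta r t pp w N A)%:E).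
Proof.
apply/measurable_EFinP.
apply: (prefix_measurable_fun (K := fun=> m) (X := fun n (w : Omega m) => w n)
  (h := fun w => level_eta r t pp w N A) (N := N)).
  by move=> n a; exact: measurable_letter.
exact: level_eta_prefix.
Qed.

(** Measurability in [w] is carried along because additivity of the integral uses it in the
    complement and union steps. *)
Let disintegrates (A : set R) := measurable_fun setT (eta ^~ A) /\
  mu A = (\int[P]_w eta w A)%E.

(** At each level the integral of [level_eta] over [w] equals [level_mu] exactly. Both sides
    converge, the integrals by dominated convergence with bound 1. *)
Let disintegrates_ray (x : R) : disintegrates [set y | y <= x].
Proof.
pose A N := [set y | y <= x + M *+ 2 * rho ^+ N].
have cv (w : Omega m) : (level_eta r t pp w N (A N))%:E @[N --> \oo] --> eta w [set y | y <= x].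
  exact: (level_eta_cvg (x := x) (@etabar_prod w) rho0 rho1 M0 r_rho rtM).
have mcv := level_mu_cvg (x := x) q0 pp0 rho0 rho1 M0 r_rho mu_selfsim muM.
have meta : measurable_fun setT (eta ^~ [set y | y <= x]).
  apply: (emeasurable_fun_cvg
    (fun N (w : Omega m) => (level_eta r t pp w N (A N))%:E)) => [N|w _].
    exact: measurable_level.
  exact: cv.
split=> //.
have bnd : \forall w \ae P, forall N, setT w ->
    (`|(level_eta r t pp w N (A N))%:E| <= (cst 1 w : \bar R))%E.
  apply: aeW => w N _; rewrite gee0_abs ?lee_fin; first exact: level_eta_le1.
  exact: level_eta_ge0.
have [_ _ icv] := @dominated_convergence _ _ _ P setT measurableT
  (fun N (w : Omega m) => (level_eta r t pp w N (A N))%:E) (eta ^~ [set y | y <= x])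
  (cst 1%E) (fun N => measurable_level N (A N)) meta
  (aeW P (fun w _ => cv w)) (finite_measure_integrable_cst P 1 measurableT) bnd.
rewrite -(cvg_lim _ icv)// -(cvg_lim _ mcv)//; congr (limn _); apply/funext => N.
by rewrite /= (integral_level_eta r t N _ Pq pp0).
Qed.

Let eta_setC w A : measurable A -> (eta w A + eta w (~` A) = 1)%E.
Proof.
move=> mA; rewrite /eta /eta_meas -(probability_setT (etabar w)).
rewrite -(measureU (etabar w)).
- by rewrite preimage_setC setUv.
- exact: measurable_coding_preimage.
- by apply: measurable_coding_preimage; exact: measurableC.
- by rewrite preimage_setC setICr.
Qed.

Let disintegratesC A : measurable A -> disintegrates A -> disintegrates (~` A).
Proof.
move=> mA [fA EA].
have efin w B : measurable B -> eta w B \is a fin_num.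
  by move=> mB; apply: fin_num_measure; exact: measurable_coding_preimage.
have EC w : eta w (~` A) = (1 - eta w A)%E.
  by rewrite -(eta_setC w mA) addeAC subee ?add0e ?efin.
have mC : measurable_fun setT (eta ^~ (~` A)).
  under eq_fun do rewrite EC.
  by apply: emeasurable_funB => //; exact: measurable_cst.
split=> //.
have : (\int[P]_w eta w A + \int[P]_w eta w (~` A) = 1)%E.
  rewrite -ge0_integralD//; [|by move=> w _; exact: measure_ge0..].
  under eq_integral do rewrite eta_setC//.
  by rewrite integral_cst// mul1e; exact: probability_setT.
rewrite -EA probability_setC// => <-.
by rewrite addeAC subee ?add0e// fin_num_measure.
Qed.

Let disintegrates_bigcup (F : (set R)^nat) : (forall n, measurable (F n)) ->
  trivIset setT F -> (forall n, disintegrates (F n)) ->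
  disintegrates (\bigcup_n F n).
Proof.
move=> mF tF dF.
have E w : eta w (\bigcup_n F n) = (\sum_(0 <= n <oo) eta w (F n))%E.
  rewrite /eta /eta_meas preimage_bigcup measure_bigcup//.
  - by apply: eq_eseriesl => n; rewrite in_setT.
  - by move=> n _; exact: measurable_coding_preimage.
  - by apply/trivIsetP => i j _ _ ij; rewrite -preimage_setI;
    have -> := (iffLR trivIsetP) tF i j I I ij; rewrite preimage_set0.
split.
  under eq_fun do rewrite E.
  apply: ge0_emeasurable_sum => [n w _ _|n _]; [exact: measure_ge0|exact: (dF n).1].
under eq_integral do rewrite E.
rewrite integral_nneseries//; last by move=> n; exact: (dF n).1.
rewrite measure_bigcup// (@eq_eseriesl _ _ xpredT); last by move=> n; rewrite in_setT.
apply: eq_eseriesr => n _; exact: (dF n).2.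
Qed.

(** A pi-lambda argument: the open rays []x, +oo[] generate the Borel sets and are stable under
    intersection. *)
Lemma disintegration A : measurable A -> mu A = (\int[P]_w eta_meas r t w (etabar w) A)%E.
Proof.
move=> mA; suff [] : disintegrates A by [].
have ER := RGenOInfty.measurableE R.
have sA : <<s @RGenOInfty.G R >> A by rewrite -[X in X A]ER.
move: A sA {mA}; apply: (dynkin_induction ER) => //.
- move=> _ _ [x ->] [y ->]; exists (Num.max x y).
  apply/seteqP; split=> z /=; rewrite !in_itv/= !andbT gt_max; last by move/andP.
  by move=> [-> ->].
- rewrite -setC0; apply: disintegratesC => //; split.
    rewrite /eta /eta_meas; under eq_fun do rewrite preimage_set0 measure0.
    exact: measurable_cst.
  by rewrite measure0 integral0_eq// => w _; rewrite /eta /eta_meas preimage_set0 measure0.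
(* The generator is the complement of a closed left ray, already treated. *)
- move=> _ [x ->]; rewrite -setCitvl set_itvNyc; apply: disintegratesC => //.
  exact: measurable_ray.
Qed.
End disintegration.

(** * Almost sure absence of atoms *)

Section non_atomic.
Context {R : realType} {m : nat} {k : 'I_m.+1 -> nat}.
Variables (r : 'I_m.+1 -> R) (t : forall i : 'I_m.+1, 'I_(k i).+1 -> R).
Variables (q : 'I_m.+1 -> R) (pp : forall i : 'I_m.+1, 'I_(k i).+1 -> R).
Variables (rho M : R) (P : probability (Omega m) R).
Variable etabar : forall w : Omega m, probability (Xinf (digits k w)) R.
Hypothesis pp0 : forall i u, 0 <= @pp i u.
Hypotheses (rho0 : 0 <= rho) (rho1 : rho < 1) (M0 : 0 <= M).
Hypothesis r_rho : forall i, `|r i| <= rho.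
Hypothesis rtM : forall i u, `|r i| * M + `|t (i := i) u| <= M.
Hypothesis Pq : forall N (w : Omega m),
  P [set v : Omega m | forall j, (j < N)%N -> v j = w j] =
  (\prod_(j < N) q (w j))%:E.
Hypothesis etabar_prod : forall w : Omega m,
  is_product_measure (fun j => @pp (w j)) (etabar w).
Hypotheses (r0 : forall i, r i != 0) (ssc : strong_separation r t).
Variable g : 'I_m.+1 -> R.
Hypotheses (q0 : forall i, 0 <= q i) (pp_g : forall i u, @pp i u <= g i).
Hypothesis qg1 : \sum_i q i * g i < 1.

Let g0 i : 0 <= g i. Proof. exact: le_trans (pp0 ord0) (pp_g _). Qed.

(** Bounds the [etabar w]-mass of every cylinder of length [N]. *)
Let gprod N (w : nat -> 'I_m.+1) := \prod_(j < N) g (w j).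

Let gprod_ge0 N w : 0 <= gprod N w.
Proof. by apply: prodr_ge0 => j _. Qed.

Let gprod_prefix N : prefix_dep (K := fun=> m) N (gprod N).
Proof. by move=> u v uv; apply: eq_bigr => j _; rewrite uv. Qed.

(** Letters are independent, so the mean of the product is a power; the constant [c] absorbs the
    letters already read. *)
Let expect_gprod N c : expect (K := fun=> m) N (fun=> q) (fun w => c * gprod N w) =
  c * (\sum_i q i * g i) ^+ N.
Proof.
elim: N c => [|N IH] c; first by rewrite /= /gprod big_ord0.
rewrite exprS mulrA mulr_sumr mulr_suml; apply: eq_bigr => i _.
transitivity (q i * (c * g i * (\sum_i q i * g i) ^+ N)); last by ring.
rewrite -IH; congr (_ * expect _ _ _).
by apply/funext => w; rewrite /gprod big_ord_recl mulrA.
Qed.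

Let integral_gprod N : (\int[P]_w (gprod N w)%:E = ((\sum_i q i * g i) ^+ N)%:E)%E.
Proof.
transitivity ((1 * expect (K := fun=> m) N (fun=> q) (gprod N))%:E); last first.
  rewrite mul1r -[RHS]mul1e -EFinM -expect_gprod; congr (expect _ _ _)%:E.
  by apply/funext => w; rewrite mul1r.
apply: (@integral_prefix _ _ _ P N (fun=> m) (fun=> q) (fun n (w : Omega m) => w n) (gprod N)) => //.
- by move=> n a; exact: measurable_letter.
- by move=> n v; rewrite mul1r setTI; exact: Pq.
Qed.

Let measurable_gprod N : measurable_fun setT (gprod N : Omega m -> R).
Proof.
apply: (prefix_measurable_fun (K := fun=> m) (X := fun n (w : Omega m) => w n)
  (h := gprod N) (N := N)) => //.
by move=> n a; exact: measurable_letter.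
Qed.

(** The mean of [gprod N] decays geometrically by [qg1], so the event [e <= gprod N w] has
    probability tending to 0, and the intersection of these events over [N] is null. *)
Let gprod_small (e : R) : 0 < e ->
  {ae P, forall w : Omega m, exists N, gprod N w < e}.
Proof.
move=> e0.
have mE N : measurable [set w : Omega m | e <= gprod N w].
  rewrite (_ : mkset _ = setT `&` (gprod N : Omega m -> R) @^-1` `[e, +oo[%classic).
    exact: measurable_gprod.
  by apply/seteqP; split=> w /=; rewrite in_itv/= andbT => // -[].
exists (\bigcap_N [set w : Omega m | e <= gprod N w]); split.
- exact: bigcapT_measurable.
- apply/eqP; rewrite eq_le measure_ge0 andbT.
  have cv : (e^-1 * (\sum_i q i * g i) ^+ N)%:E @[N --> \oo] --> (0%:E : \bar R).
    apply: cvg_EFin; first exact: nearW.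
    rewrite -[X in _ --> X](mulr0 e^-1); apply: cvgMr; apply: cvg_expr.
    by rewrite ger0_norm// sumr_ge0// => i _; rewrite mulr_ge0.
  rewrite -[leRHS](cvg_lim _ cv)//; apply: lime_ge; first by apply/cvg_ex; eexists; exact: cv.
  apply: nearW => N.
  (* Markov's inequality, comparing [e] times an indicator with [gprod N]. *)
  rewrite EFinM lee_pdivlMl// -integral_gprod.
  apply: (@le_trans _ _ (e%:E * P [set w : Omega m | (e <= gprod N w)%R])%E).
    rewrite lee_pmul2l//; apply: le_measure; rewrite ?inE//.
      exact: bigcapT_measurable.
    exact: bigcap_inf.
  rewrite -[X in P X]setIT -integral_indic// -ge0_integralZl//.
  apply: ge0_le_integral => //.
  - by move=> w _; rewrite lee_fin mulr_ge0 ?indicE// ltW.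
  - by apply: measurable_funeM; apply/measurable_EFinP; exact: measurable_indic.
  - by apply/measurable_EFinP; exact: measurable_gprod.
  - move=> w _; rewrite lee_fin indicE; have [|_] := boolP (_ \in _).
      by rewrite inE/= mulr1.
    by rewrite mulr0.
  - by apply/measurable_EFinP; exact: measurable_indic.
  - by rewrite lee_fin ltW.
- move=> w /= H N _ /=; rewrite leNgt; apply/negP => Hw; apply: H.
  by exists N.
Qed.

(** As the coding is injective, the fibre over [x] is at most one sequence [u0]. It lies in every
    cylinder around [u0], and these have mass at most [gprod N w]. *)
Lemma non_atomic_ae :
  {ae P, forall w : Omega m, non_atomic (eta_meas r t w (etabar w))}.
Proof.
(* Countably many thresholds keep the exceptional set null, and it does not depend on [x]. *)
have : {ae P, forall (w : Omega m) n, exists N, gprod N w < n.+1%:R^-1}.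
  by apply: ae_foralln => n; apply: gprod_small; rewrite invr_gt0.
apply: filterS => w small x; rewrite /eta_meas.
have mx : measurable (coding r t w @^-1` [set x]).
  rewrite -[X in measurable X]setTI.
  exact: (measurable_coding rho0 rho1 M0 r_rho rtM).
have [->|/set0P[u0 /= u0x]] := eqVneq (coding r t w @^-1` [set x]) set0.
  by rewrite measure0.
apply/eqP; rewrite eq_le measure_ge0 andbT.
have cv : (n.+1%:R^-1)%:E @[n --> \oo] --> (0%:E : \bar R).
  apply: cvg_EFin; first exact: nearW.
  exact: cvg_harmonic.
rewrite -[leRHS](cvg_lim _ cv)//; apply: lime_ge; first by apply/cvg_ex; eexists; exact: cv.
apply: nearW => n; have [N HN] := small n.
have mcyl : measurable [set u : Xinf (digits k w) | forall j, (j < N)%N -> u j = u0 j].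
  rewrite -[X in measurable X]setTI.
  apply: (prefix_measurable (N := N) (X := fun n (u : Xinf (digits k w)) => u n)
    (H := fun u => forall j, (j < N)%N -> u j = u0 j)) => //.
    exact: measurable_digit.
  by move=> u v uv; apply/propext; split=> H j jN; rewrite -H// uv.
apply: (@le_trans _ _ (etabar w [set u | forall j, (j < N)%N -> u j = u0 j])).
  apply: le_measure; rewrite ?inE// => u /= ux j _.
  by rewrite (coding_inj rho0 rho1 M0 r_rho rtM r0 ssc (etrans ux (esym u0x))).
rewrite etabar_prod lee_fin (le_trans _ (ltW HN))//.
by apply: ler_prod => j _; rewrite pp0 pp_g.
Qed.
End non_atomic.

(** * Existence of Bernoulli measures *)

Lemma uniform_prob_itv {R : realType} (a b : R) : 0 <= a -> a <= b -> b <= 1 ->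
  uniform_prob (@ltr01 R) `[a, b[%classic = (b - a)%:E.
Proof.
move=> a0 ab b1; rewrite /uniform_prob integral_uniform_pdf.
rewrite (_ : _ `&` _ = `[a, b[%classic); last first.
  apply/seteqP; split=> x /=; rewrite !in_itv/=; first by case.
  by move=> /andP[ax xb]; rewrite ax xb (le_trans a0 ax) (ltW (lt_le_trans xb b1)).
rewrite (eq_integral (fun=> 1%E)); last first.
  move=> x; rewrite inE/= in_itv/= => /andP[ax xb]; rewrite /uniform_pdf.
  by rewrite (le_trans a0 ax) (ltW (lt_le_trans xb b1)) subr0 invr1.
rewrite integral_cst//= mul1e lebesgue_measure_itv/= lte_fin; case: ltgtP ab => // -> _.
by rewrite subrr.
Qed.

Section bernoulli.
Context {R : realType} {m : nat}.
Variable q : 'I_m.+1 -> R.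
Hypotheses (q_gt0 : forall i, 0 < q i) (q1 : \sum_i q i = 1).

(* [0, 1[ is cut into consecutive cells of lengths [q i]; [expand] maps each
   cell affinely onto [0, 1[, and the itinerary of a uniform point under
   [expand] is an i.i.d. sequence. *)
Definition cell_start (n : nat) : R := \sum_(j < m.+1 | (j < n)%N) q j.

Definition cell_index (x : R) : 'I_m.+1 :=
  odflt ord0 [pick i : 'I_m.+1 | cell_start i <= x < cell_start i.+1].

Definition expand (x : R) : R := (x - cell_start (cell_index x)) / q (cell_index x).

Let cell_start0 : cell_start 0 = 0.
Proof. by rewrite /cell_start big_pred0. Qed.

Let cell_startT : cell_start m.+1 = 1.
Proof. by rewrite -q1; apply: eq_bigl => j; exact: ltn_ord. Qed.

Let cell_startS (i : 'I_m.+1) : cell_start i.+1 = cell_start i + q i.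
Proof.
rewrite /cell_start (bigD1 i)//= addrC; congr (_ + _); apply: eq_bigl => j.
by rewrite ltnS [RHS]ltn_neqAle andbC.
Qed.

Let cell_start_mono : {homo cell_start : a b / (a <= b)%N >-> a <= b}.
Proof.
move=> a b ab; rewrite /cell_start big_mkcond [leRHS]big_mkcond; apply: ler_sum => j _.
case: ifPn => [ja|_]; first by rewrite (leq_trans ja ab).
by case: ifPn => // _; exact: ltW.
Qed.

Let cell_indexP x : 0 <= x < 1 ->
  cell_start (cell_index x) <= x < cell_start (cell_index x).+1.
Proof.
move=> /andP[x0 x1]; rewrite /cell_index; case: pickP => [//|none].
(* The cell of [x] ends at the first [cell_start n] exceeding [x]. *)
have ex : exists n, x < cell_start n by exists m.+1; rewrite cell_startT.
case: (ex_minnP ex) => -[|n] xn nmin; first by rewrite cell_start0 ltNge x0 in xn.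
have nm : (n < m.+1)%N by apply: nmin; rewrite cell_startT.
have := none (Ordinal nm); rewrite /= xn andbT leNgt => /negP/negP xn'.
by have := nmin _ xn'; rewrite ltnn.
Qed.

Let cell_uniq x i j : cell_start i <= x < cell_start i.+1 ->
  cell_start j <= x < cell_start j.+1 -> i = j.
Proof.
move=> /andP[ix xi] /andP[jx xj]; apply/eqP; rewrite eqn_leq; apply/andP; split.
  rewrite leqNgt; apply/negP => /cell_start_mono; rewrite leNgt.
  by rewrite (le_lt_trans ix xj).
rewrite leqNgt; apply/negP => /cell_start_mono; rewrite leNgt.
by rewrite (le_lt_trans jx xi).
Qed.

Let cell_index_eq (i : 'I_m.+1) x : cell_start i <= x < cell_start i.+1 ->
  cell_index x = i.
Proof.
move=> xi; rewrite /cell_index; case: pickP => [j /= xj|/(_ i)]; last by rewrite xi.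
exact/val_inj/(cell_uniq xj xi).
Qed.

(** Points outside [[0, 1[] lie in no cell and receive the default [ord0], so only the fibre of
    [ord0] is larger than its cell. *)
Let measurable_cell_index i : measurable (cell_index @^-1` [set i]).
Proof.
pose c (j : 'I_m.+1) := `[cell_start j, cell_start j.+1[%classic : set R.
have cE j x : c j x <-> cell_start j <= x < cell_start j.+1 by rewrite /c /= in_itv.
have mC : measurable (~` \bigcup_(j in [set: 'I_m.+1]) c j).
  by apply: measurableC; apply: fin_bigcup_measurable => // *; exact: measurable_itv.
have [->|i0] := eqVneq i ord0.
  rewrite (_ : _ @^-1` _ = c ord0 `|` ~` \bigcup_(j in [set: 'I_m.+1]) c j).
    by apply: measurableU => //; exact: measurable_itv.
  apply/seteqP; split=> x /=.
    rewrite /cell_index; case: pickP => [j /cE cj /= j0|none _].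
      by left; rewrite -j0; exact/cE.
    by right; case=> j _ /cE; rewrite none.
  move=> [/cE/cell_index_eq//|H]; rewrite /cell_index; case: pickP => // j /cE cj.
  by exfalso; apply: H; exists j.
rewrite (_ : _ @^-1` _ = c i); first exact: measurable_itv.
apply/seteqP; split=> x /=; last by move=> /cE/cell_index_eq.
rewrite /cell_index; case: pickP => [j /cE cj /= ji|_ /= i00].
  by rewrite -ji.
by rewrite -i00 eqxx in i0.
Qed.

Let expand_ge0_lt1 x : 0 <= x < 1 -> 0 <= expand x < 1.
Proof.
move=> /cell_indexP; rewrite cell_startS /expand => /andP[xl xr].
apply/andP; split; first by rewrite divr_ge0 ?subr_ge0// ltW.
by rewrite ltr_pdivrMr// mul1r ltrBlDl.
Qed.

Let measurable_expand : measurable_fun setT expand.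
Proof.
rewrite (_ : expand = fun x => \sum_(i < m.+1)
    \1_(cell_index @^-1` [set i]) x * ((x - cell_start i) / q i)); last first.
  apply/funext => x; rewrite (bigD1 (cell_index x))//= indicE mem_set// mul1r.
  rewrite big1 ?addr0// => i /eqP xi; rewrite indicE memNset ?mul0r// => E.
  by apply: xi; rewrite E.
apply: measurable_sum => i; apply: measurable_funM.
  exact: measurable_indic.
by apply: measurable_funM => //; exact: measurable_funB.
Qed.

Definition itinerary (x : R) : Omega m := fun n => cell_index (iter n expand x).

Let measurable_itinerary : measurable_fun setT itinerary.
Proof.
have miter n : measurable_fun setT (iter n expand).
  elim: n => [|n IH]; first exact: measurable_id.
  exact: (measurableT_comp measurable_expand IH).
apply: measurability => // _ [_ [n [a ->]] <-].
rewrite setTI; have := miter n measurableT _ (measurable_cell_index a).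
by rewrite setTI.
Qed.

(** The interval of the shifted word is carried back through the affine branch of the first cell,
    which multiplies its length by the weight of the first letter. *)
Let itinerary_cylinder N (w : nat -> 'I_m.+1) : exists2 a, 0 <= a /\ a + \prod_(j < N) q (w j) <= 1 &
  forall x, (0 <= x < 1 /\ forall j, (j < N)%N -> itinerary x j = w j) <->
    a <= x < a + \prod_(j < N) q (w j).
Proof.
elim: N w => [|N IH] w.
  exists 0; first by rewrite big_ord0 add0r.
  by move=> x; rewrite big_ord0 add0r; split=> [[]|].
have [a [a0 aL] H] := IH (fun n => w n.+1).
rewrite big_ord_recl/=.
set L := \prod_(j < N) _ in aL H *.
have q0 := q_gt0 (w 0%N).
have L0 : 0 <= L by apply: prodr_ge0 => j _; exact: ltW.
have c0 : 0 <= cell_start (w 0%N) by rewrite -cell_start0 cell_start_mono.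
have c1 : cell_start (w 0%N) + q (w 0%N) <= 1.
  by rewrite -cell_startS -cell_startT cell_start_mono.
have affine x : (a <= (x - cell_start (w 0%N)) / q (w 0%N) < a + L) =
    (cell_start (w 0%N) + q (w 0%N) * a <= x <
      cell_start (w 0%N) + q (w 0%N) * a + q (w 0%N) * L).
  rewrite ler_pdivlMr// ltr_pdivrMr// lerBrDl ltrBlDl.
  by rewrite -addrA -mulrDr ![_ * q _]mulrC.
(* The image of [a] under the inverse branch [z |-> cell_start (w 0) + q (w 0) * z]. *)
exists (cell_start (w 0%N) + q (w 0%N) * a).
  split; first by rewrite addr_ge0// mulr_ge0// ltW.
  by rewrite -addrA -mulrDr (le_trans _ c1)// lerD2l ler_piMr// ltW.
move=> x; rewrite -affine; split.
  move=> [x01 xw]; have xw0 : cell_index x = w 0%N := xw 0%N isT.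
  rewrite -xw0; apply/H; split; first exact: expand_ge0_lt1.
  by move=> j jN; have := xw j.+1 jN; rewrite /itinerary iterSr.
move=> xaL.
have xcell : cell_start (w 0%N) <= x < cell_start (w 0%N).+1.
  move: xaL; rewrite affine cell_startS => /andP[xl xr]; apply/andP; split.
    by rewrite (le_trans _ xl)// lerDl mulr_ge0// ltW.
  by rewrite (lt_le_trans xr)// -addrA -mulrDr lerD2l ler_piMr// ltW.
have xw0 := cell_index_eq xcell.
move: xaL; rewrite -xw0 => /H[_ xw]; split.
  move: xcell; rewrite cell_startS => /andP[xl xr].
  by rewrite (le_trans c0 xl) (lt_le_trans xr).
by move=> [//|j] jN; rewrite -(xw j jN) /itinerary iterSr.
Qed.

(** The witness is the law of the itinerary of a uniform point. *)
Lemma bernoulli_exists : exists P : probability (Omega m) R,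
  forall N (w : Omega m), P [set v : Omega m | forall j, (j < N)%N -> v j = w j] =
    (\prod_(j < N) q (w j))%:E.
Proof.
have mF : measurable_fun (setT : set (measurableTypeR R)) itinerary.
  exact: measurable_itinerary.
exists (distribution (uniform_prob (@ltr01 R)) (@mfun_Sub _ _ (measurableTypeR R) (Omega m) itinerary (mem_set mF))) => N w.
rewrite /distribution /pushforward /=.
set B := _ @^-1` _.
have mB : measurable B.
  rewrite -[B]setTI; apply: measurable_itinerary => //.
  rewrite -[X in measurable X]setTI.
  apply: (prefix_measurable (K := fun=> m) (N := N) (X := fun n (v : Omega m) => v n)
    (H := fun v => forall j, (j < N)%N -> v j = w j)) => //.
    by move=> n a; exact: measurable_letter.
  by move=> u v uv; apply/propext; split=> H j jN; rewrite -H// uv.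
have U01 : uniform_prob (@ltr01 R) `[0, 1[%classic = 1%E.
  by rewrite uniform_prob_itv// subr0.
have m01 : measurable (`[0, 1[%classic : set (measurableTypeR R)).
  exact: measurable_itv.
have [a [a0 aL] aE] := itinerary_cylinder N w.
have mB' : measurable (B : set (measurableTypeR R)) by [].
(* Split [B] along [[0, 1[]: the outer part is null, the inner part is the interval given by
   [itinerary_cylinder]. *)
rewrite (measureDI _ mB' m01).
rewrite [X in (X + _)%E](_ : _ = 0%E); last first.
  apply: (@subset_measure0 _ (measurableTypeR R) _ _ _ (~` `[0, 1[%classic)).
  - exact: measurableD.
  - exact: measurableC.
  - by move=> x [].
  - rewrite -[LHS]/(uniform_prob (@ltr01 R) _).
    have := probability_setC (uniform_prob (@ltr01 R)) m01.
    by rewrite /= U01 subee// => <-.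
rewrite add0e; transitivity (uniform_prob (@ltr01 R) `[a, a + \prod_(j < N) q (w j)[%classic).
  congr (uniform_prob (@ltr01 R) _).
  apply/seteqP; split=> x /=; rewrite !in_itv/=.
    by move=> [Bx x01]; apply/aE.
  by move=> /aE[].
have L0 : 0 <= \prod_(j < N) q (w j) by apply: prodr_ge0 => j _; exact: ltW.
rewrite (uniform_prob_itv a0 _ aL); last by rewrite lerDl.
by congr (_ %:E); rewrite addrC addKr.
Qed.
End bernoulli.

(** * Shift invariance of Bernoulli measures *)

Section shift_invariance.
Context {R : realType} {m : nat}.
Variables (q : 'I_m.+1 -> R) (P : probability (Omega m) R).
Hypothesis q1 : \sum_i q i = 1.
Hypothesis Pq : forall N (w : Omega m),
  P [set v : Omega m | forall j, (j < N)%N -> v j = w j] =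
  (\prod_(j < N) q (w j))%:E.

(** Events fixing a single letter are not stable under intersection in general; events on finitely
    many letters are, and they generate the same sigma-algebra. *)
Let prefix_sets : set (set (Omega m)) := [set A | exists N (H : (nat -> 'I_m.+1) -> Prop),
  prefix_dep (K := fun=> m) N H /\ A = [set w : Omega m | H w]].

Let measurable_prefix N (H : (nat -> 'I_m.+1) -> Prop) :
  prefix_dep (K := fun=> m) N H -> measurable [set w : Omega m | H w].
Proof.
move=> HN; rewrite -[X in measurable X]setTI.
apply: (prefix_measurable (K := fun=> m) (N := N) (X := fun n (v : Omega m) => v n)) => //.
by move=> n a; exact: measurable_letter.
Qed.

Let prob_prefix N (H : (nat -> 'I_m.+1) -> Prop) : prefix_dep (K := fun=> m) N H ->
  P [set w : Omega m | H w] =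
  (expect (K := fun=> m) N (fun=> q) (fun w => (`[< H w >])%:R))%:E.
Proof.
move=> HN; rewrite -[RHS]mul1e -EFinM.
rewrite -(@integral_prefix _ _ _ P N (fun=> m) (fun=> q)
    (fun n (w : Omega m) => w n) (fun w => (`[< H w >])%:R) setT).
- rewrite -[X in P X]setIT -integral_indic//; exact: measurable_prefix HN.
- by move=> n a; exact: measurable_letter.
- exact: measurableT.
- by move=> n v; rewrite mul1r setTI; exact: Pq.
- by move=> u v uv; rewrite (HN _ _ uv).
- by move=> v; rewrite ler0n.
Qed.

Let measurable_shift : measurable_fun setT (Defs.shift : Omega m -> Omega m).
Proof.
apply: measurability => // _ [_ [n [a ->]] <-].
by rewrite setTI; exact: (measurable_letter n.+1 a).
Qed.

(** [P] and its image under the shift agree on the pi-system [prefix_sets], hence everywhere. *)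
Lemma bernoulli_shift_invariant : shift_invariant P.
Proof.
move=> A mA; apply/esym.
pose P' := distribution P (mfun_Sub (mem_set measurable_shift)).
have mE : (@measurable _ (Omega m)) = <<s prefix_sets >>.
  apply/seteqP; split.
    apply: smallest_sub; first exact: smallest_sigma_algebra.
    move=> _ [n [a ->]]; apply: sub_sigma_algebra.
    exists n.+1, (fun w => w n = a); split=> // u v uv.
    by rewrite (uv n).
  apply: smallest_sub; first exact: sigma_algebra_measurable.
  by move=> _ [N [H [HN ->]]]; exact: measurable_prefix HN.
apply: (@measure_unique _ _ _ prefix_sets (fun=> setT) mE _ _ _ P P') => //.
- move=> _ _ [N [H [HN ->]]] [N' [H' [HN' ->]]].
  exists (maxn N N'), (fun w => H w /\ H' w); split=> // u v uv.
  rewrite (HN u v) ?(HN' u v)// => j jN; apply: uv; rewrite leq_max jN ?orbT//.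
- by move=> _; exists 0%N, (fun=> True); split=> //; apply/seteqP.
- by apply/seteqP; split=> // w _; exists 0%N.
- move=> _ [N [H [HN ->]]]; rewrite /P' /distribution /pushforward /=.
  have HS : prefix_dep (K := fun=> m) N.+1 (fun w : nat -> 'I_m.+1 => H (fun n => w n.+1)).
    by move=> u v uv; apply: HN => j jN; exact: (uv j.+1).
  (* The shifted event ignores the first letter, which is summed out with total weight 1. *)
  rewrite (prob_prefix HN) [RHS](prob_prefix HS) /=.
  by rewrite -mulr_suml q1 mul1r.
- by move=> _; rewrite -ge0_fin_numE// fin_num_measure.
Qed.
End shift_invariance.

(** * Merging two letters into one letter with two maps *)

(** The letters of the model will be all words except [b], which is attached to [a]; the presence of
    [a] makes the index type nonempty, as the form ['I_m.+1] requires. *)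
Lemma enum_but_one (T : finType) (a b : T) : a != b ->
  exists m (iota : 'I_m.+1 -> T), injective iota /\
    (forall w, w != b -> exists i, iota i = w) /\
    (forall (V : nmodType) (F : T -> V), \sum_(w | w != b) F w = \sum_i F (iota i)).
Proof.
move=> ab; have aA : a \in [set~ b]%SET by rewrite !inE.
case E : #|[set~ b]%SET| => [|m]; first by move: (card0_eq E a); rewrite aA.
exists m, (fun i => enum_val (cast_ord (esym E) i)); split; [|split].
- by move=> i j /enum_val_inj /cast_ord_inj.
- move=> w wb; have wA : w \in [set~ b]%SET by rewrite !inE.
  exists (cast_ord E (enum_rank_in wA w)).
  by rewrite cast_ordK enum_rankK_in.
- move=> V F; rewrite (eq_bigl (mem [set~ b]%SET)); last by move=> w; rewrite /= !inE.
  rewrite big_enum_val (reindex (cast_ord (esym E)))//.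
  by apply: onW_bij; exists (cast_ord E); [exact: cast_ordKV|exact: cast_ordK].
Qed.

Section merge.
Context {R : realType} {T : finType}.
Variables (s t p : T -> R) (a b : T) (rho M : R) (mu : probability R R).
Hypotheses (p_gt0 : forall w, 0 < p w) (p1 : \sum_w p w = 1).
Hypotheses (rho0 : 0 <= rho) (rho1 : rho < 1) (M0 : 0 <= M).
Hypotheses (s0 : forall w, s w != 0) (s_rho : forall w, `|s w| <= rho).
Hypothesis stM : forall w, `|s w| * M + `|t w| <= M.
Hypotheses (ab : a != b) (sab : s a = s b).
Hypothesis sep : forall x y, `|x| <= M + 1 -> `|y| <= M + 1 ->
  s a * x + t a <> s b * y + t b.
Hypothesis mu_selfsim : forall A, measurable A ->
  mu A = (\sum_w (p w)%:E * mu ((fun x => s w * x + t w)%R @^-1` A))%E.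

(** Only [a] and [b] share a letter, so only they have to be separated. The radius is [M + 1]
    because [selfsim_concentrated] gives full mass on balls of radius larger than [M]. *)
Lemma merge_model : exists (m : nat) (k : 'I_m.+1 -> nat) (r : 'I_m.+1 -> R)
    (tt : forall i : 'I_m.+1, 'I_(k i).+1 -> R)
    (pp : forall i : 'I_m.+1, 'I_(k i).+1 -> R)
    (P : probability (Omega m) R),
  (forall i, r i != 0 /\ `|r i| < 1) /\
  (forall i, pos_prob_vector (pp i)) /\
  shift_invariant P /\ bernoulli_measure P /\ strong_separation r tt /\
  (forall etabar : forall w : Omega m, probability (Xinf (digits k w)) R,
    (forall w : Omega m, is_product_measure (fun j => pp (w j)) (etabar w)) ->
    {ae P, forall w : Omega m, non_atomic (eta_meas r tt w (etabar w))} /\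
    (forall A : set R, measurable A ->
      mu A = (\int[P]_w eta_meas r tt w (etabar w) A)%E)) /\
  (forall w, w != b -> exists i, r i = s w).
Proof.
have [m [iota [iota_inj [iota_surj iota_sum]]]] := enum_but_one ab.
have [ia iaE] := iota_surj _ ab.
(* Alphabet sizes are stored minus one: the letter of [a] has two digits, every other letter has
   one. *)
pose k i : nat := iota i == a.
(* Digit 0 is the letter's own word; digit 1 exists only for the letter of [a] and stands for
   [b]. *)
pose word i (u : 'I_(k i).+1) := if u == 0%N :> nat then iota i else b.
have u_le i (u : 'I_(k i).+1) : (u <= (iota i == a))%N := ltn_ord u.
have wordP i (u : 'I_(k i).+1) : (u = 0%N :> nat /\ word i u = iota i) \/
    [/\ u = 1%N :> nat, iota i = a & word i u = b].
  rewrite /word; have := u_le i u; case: (nat_of_ord u =P 0%N) => [-> _|u0]; first by left.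
  case: eqP => [iE u1|_]; last by rewrite leqn0 => /eqP/u0.
  by right; split=> //; apply/eqP; rewrite eqn_leq u1 lt0n; apply/eqP.
have s_word i u : s (word i u) = s (iota i).
  by case: (wordP i u) => [[_ ->]//|[_ -> ->]].
(* Pairs of a letter and a digit enumerate all words once, [b] being digit 1 of the letter [ia]. *)
have word_sum (V : nmodType) (F : T -> V) :
    \sum_i \sum_(u < (k i).+1) F (word i u) = \sum_w F w.
  rewrite [RHS](bigD1 b)//= iota_sum addrC.
  under eq_bigr do rewrite big_ord_recl/=.
  rewrite big_split/=; congr (_ + _).
  rewrite (bigD1 ia)//= [X in _ + X]big1 ?addr0; last first.
    move=> i iia; rewrite big1// => u _.
    have iNa : (iota i == a) = false.
      by apply: contra_neqF iia => /eqP iaa; apply: iota_inj; rewrite iaE.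
    by have : (u < (iota i == a))%N := ltn_ord u; rewrite iNa.
  have kia : k ia = 1%N by rewrite /k iaE eqxx.
  by rewrite (eq_bigr (fun=> F b))// sumr_const card_ord kia.
(* A letter gets the total weight of its words and [pp] is the conditional weight, so [q i * pp i u]
   is the weight of the word. *)
pose q i := \sum_(u < (k i).+1) p (word i u).
pose pp i (u : 'I_(k i).+1) := p (word i u) / q i.
have p_le_q i u : p (word i u) <= q i.
  by rewrite /q (bigD1 u)//= lerDl sumr_ge0// => v _; exact: ltW.
have q_gt0 i : 0 < q i by exact: lt_le_trans (p_gt0 _) (p_le_q i ord0).
have q1 : \sum_i q i = 1 by rewrite /q word_sum.
have pp1 i : \sum_u pp i u = 1.
  by rewrite -mulr_suml; apply: divff; rewrite gt_eqF ?(q_gt0 i).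
have pp_gt0 i u : 0 < pp i u by rewrite divr_gt0.
have q_pp i u : q i * pp i u = p (word i u) by rewrite mulrC divfK// gt_eqF.
pose r i := s (iota i).
pose tt i (u : 'I_(k i).+1) := t (word i u).
have mapE i u : model_map r tt i u = (fun x => s (word i u) * x + t (word i u)).
  by apply/funext => x; rewrite /model_map s_word.
have r_rho i : `|r i| <= rho by exact: s_rho.
have rtM i u : `|r i| * M + `|tt i u| <= M by rewrite /r -(s_word i u).
have rtM1 i u : `|r i| * (M + 1) + `|tt i u| <= M + 1.
  rewrite mulrDr mulr1 addrAC lerD//.
  exact: le_trans (r_rho i) (ltW rho1).
have M10 : 0 <= M + 1 by rewrite addr_ge0.
have selfsim A : measurable A ->
  mu A = (\sum_i \sum_(u < (k i).+1) (q i * pp i u)%:E * mu (model_map r tt i u @^-1` A))%E.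
  move=> mA; rewrite (mu_selfsim mA).
  rewrite -(word_sum _ (fun w => (p w)%:E * mu ((fun x => s w * x + t w)%R @^-1` A))%E).
  by apply: eq_bigr => i _; apply: eq_bigr => u _; rewrite q_pp mapE.
have muM : mu [set x | `|x| <= M + 1] = 1%E.
  apply: (selfsim_concentrated (fun i => ltW (q_gt0 i)) (fun i u => ltW (pp_gt0 i u))
    pp1 rho0 M0 r_rho rtM q1 selfsim rho1 ltr01).
have [P Pq] := bernoulli_exists q_gt0 q1.
have ssc : strong_separation r tt.
  apply: (strong_separation_bounded rho0 rho1 M10 r_rho rtM1).
  move=> i u v x y uv xM yM; rewrite !mapE => E.
  have {}uv : (u : nat) != v by [].
  case: (wordP i u) (wordP i v) => [[u0 ui]|[u1 iE ub]] [[v0 vi]|[v1 iE' vb]].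
  - by rewrite u0 v0 in uv.
  - by move: E; rewrite ui vb iE'; exact: sep.
  - by move: E => /esym; rewrite ub vi iE; exact: sep.
  - by rewrite u1 v1 in uv.
exists m, k, r, tt, pp, P; split; [|split; [|split; [|split; [|split; [|split]]]]].
- by move=> i; split; [exact: s0|exact: le_lt_trans (r_rho i) rho1].
- by move=> i; split.
- exact: (bernoulli_shift_invariant q1 Pq).
- by exists q; split=> //; split=> // i; exact: ltW.
- exact: ssc.
- move=> etabar etabar_prod; split; last first.
    exact: (disintegration (fun i => ltW (q_gt0 i)) (fun i u => ltW (pp_gt0 i u))
      pp1 rho0 rho1 M10 r_rho rtM1 selfsim muM Pq etabar_prod).
  (* At the merged letter the bound is the larger conditional weight, which is below 1 because both
     words have positive weight. *)
  pose g i := if iota i == a then Num.max (p a) (p b) / (p a + p b) else 1.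
  have q_ia i : iota i = a -> q i = p a + p b.
    move=> iE; rewrite /q big_ord_recl /word/= iE; congr (_ + _).
    by rewrite (eq_bigr (fun=> p b))// sumr_const card_ord /k iE eqxx.
  have pp_g i u : pp i u <= g i.
    rewrite /g; case: eqP => [iE|_]; last by rewrite ler_pdivrMr// mul1r.
    rewrite /pp q_ia// ler_pM2r ?invr_gt0 ?addr_gt0//.
    by case: (wordP i u) => [[_ ->]|[_ _ ->]]; rewrite ?iE le_max lexx ?orbT.
  have qg1 : \sum_i q i * g i < 1.
    rewrite -q1 (bigD1 ia)//= [ltRHS](bigD1 ia)//=; apply: ltr_leD.
      rewrite -[ltRHS]mulr1 ltr_pM2l// /g iaE eqxx ltr_pdivrMr ?addr_gt0// mul1r.
      by rewrite gt_max ltrDl ltrDr !p_gt0.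
    apply: ler_sum => i _; rewrite -[leRHS]mulr1 ler_pM2l// /g.
    case: eqP => // _; rewrite ler_pdivrMr ?addr_gt0// mul1r.
    by rewrite ge_max lerDl lerDr !ltW.
  exact: (non_atomic_ae (fun i u => ltW (pp_gt0 i u)) rho0 rho1 M10 r_rho rtM1 Pq
    etabar_prod (fun i => s0 (iota i)) ssc (fun i => ltW (q_gt0 i)) pp_g qg1).
- by move=> w /iota_surj[i iE]; exists i; rewrite /r iE.
Qed.
End merge.

(** * Words of maps and their separation *)

Lemma big_tuple_cons (V : nmodType) (T : finType) N (F : seq T -> V) :
  \sum_(l : N.+1.-tuple T) F l = \sum_i \sum_(l : N.-tuple T) F (i :: l).
Proof.
rewrite pair_big/= (reindex (fun il : T * N.-tuple T => cons_tuple il.1 il.2)).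
  by apply: eq_big => // -[].
apply: onW_bij; exists (fun l => (thead l, behead_tuple l)).
  by move=> [i l]; congr (_, _); apply/val_inj.
by move=> l; rewrite [RHS]tuple_eta; exact/val_inj.
Qed.

Lemma irrationalMn (R : realType) (x : R) n :
  (0 < n)%N -> irrational x -> irrational (x *+ n).
Proof.
move=> n0 xirr [z _ zE]; apply: xirr; exists (z / n%:R) => //.
rewrite rmorphM/= fmorphV/= ratr_nat zE -[x *+ n]mulr_natr mulfK// pnatr_eq0 -lt0n//.
Qed.

Section words.
Context {R : realType} {n : nat}.
Variables (s t p : 'I_n -> R).

(** The head of the word is the outermost map. *)
Definition word_map (l : seq 'I_n) (x : R) : R := foldr (ifs_map s t) x l.

Definition word_ratio (l : seq 'I_n) : R := \prod_(i <- l) s i.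

Lemma word_mapE l x : word_map l x = word_ratio l * x + word_map l 0.
Proof.
rewrite /word_ratio; elim: l => [|i l IH] /=; first by rewrite big_nil mul1r addr0.
by rewrite big_cons {1}/ifs_map IH mulrDr !mulrA addrA.
Qed.

Lemma word_map_fixed i x N z : ifs_map s t i x = x ->
  word_map (nseq N i) z - x = s i ^+ N * (z - x).
Proof.
move=> fix_x; elim: N => [|N IH] /=; first by rewrite expr0 mul1r.
rewrite exprS -mulrA -IH -[in LHS]fix_x /ifs_map.
by rewrite opprD addrACA subrr addr0 -mulrBr.
Qed.

Variable mu : probability R R.
Hypothesis p_gt0 : forall i, 0 < p i.
Hypothesis mu_selfsim : self_similar_measure s t p mu.

Lemma word_selfsim N (A : set R) : measurable A ->
  mu A = (\sum_(l : N.-tuple 'I_n) (\prod_(i <- l) p i)%:E *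
    mu (word_map l @^-1` A))%E.
Proof.
elim: N A => [|N IH] A mA.
  rewrite (big_pred1 [tuple]) => [|l]; last by apply/esym/eqP; exact: tuple0.
  by rewrite big_nil mul1e.
rewrite (mu_selfsim mA) (big_tuple_cons N
  (fun l => (\prod_(i <- l) p i)%:E * mu (word_map l @^-1` A))%E).
apply: eq_bigr => i _; rewrite (IH (ifs_map s t i @^-1` A)); last first.
  rewrite -[X in measurable X]setTI.
  have : measurable_fun setT (ifs_map s t i).
    by apply: measurable_funD => //; apply: measurable_funM.
  by apply.
rewrite ge0_sume_distrr; last first.
  by move=> l _; rewrite mule_ge0// lee_fin prodr_ge0// => j _; exact: ltW.
by apply: eq_bigr => l _; rewrite big_cons EFinM muleA.
Qed.

(** Read off from the total mass of [mu] instead of expanding a product of sums. *)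
Lemma word_weight1 N : \sum_(l : N.-tuple 'I_n) \prod_(i <- l) p i = 1.
Proof.
apply: EFin_inj; rewrite -sumEFin -(probability_setT mu) (word_selfsim N measurableT).
by apply: eq_bigr => l _; rewrite preimage_setT probability_setT mule1.
Qed.

Variables (rho M : R).
Hypotheses (rho0 : 0 <= rho) (rho1 : rho < 1) (M0 : 0 <= M).
Hypothesis s_rho : forall i, `|s i| <= rho.
Hypothesis stM : forall i, `|s i| * M + `|t i| <= M.

Lemma word_ratio_le l : (0 < size l)%N -> `|word_ratio l| <= rho.
Proof.
have le1 l' : `|word_ratio l'| <= 1.
  rewrite /word_ratio; elim: l' => [|i l' IH]; first by rewrite big_nil normr1.
  by rewrite big_cons normrM mulr_ile1// (le_trans (s_rho i))// ltW.
case: l => // i l _; rewrite /word_ratio big_cons normrM -[leRHS]mulr1.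
by apply: ler_pM => //; exact: le1.
Qed.

(** Invariance of [[-M, M]] passes to compositions. *)
Lemma word_bound l : `|word_ratio l| * M + `|word_map l 0| <= M.
Proof.
elim: l => [|i l IH] /=; first by rewrite /word_ratio big_nil normr1 mul1r normr0 addr0.
rewrite {1}/word_ratio big_cons -/(word_ratio l) normrM /ifs_map.
rewrite (le_trans _ (stM i))// (le_trans (lerD (lexx _) (ler_normD _ _)))//.
by rewrite addrA lerD2r normrM -mulrA -mulrDr ler_wpM2l.
Qed.

Lemma word_map_bounded l x : `|x| <= M + 1 -> `|word_map l x| <= M + 1.
Proof.
have sM i : `|s i| * (M + 1) + `|t i| <= M + 1.
  rewrite mulrDr mulr1 addrAC lerD//; exact: le_trans (s_rho i) (ltW rho1).
move=> xM; elim: l => [//|i l IH] /=; rewrite (le_trans _ (sM i))//.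
by rewrite (le_trans (ler_normD _ _))// lerD2r normrM ler_wpM2l.
Qed.

Lemma fixed_point_bounded i x : ifs_map s t i x = x -> `|x| <= M.
Proof.
move=> fix_x; have s1 : `|s i| < 1 by exact: le_lt_trans (s_rho i) rho1.
have : `|x| <= `|s i| * `|x| + `|t i|.
  by rewrite -{1}fix_x -normrM; exact: ler_normD.
have := stM i => H1 H2.
have : `|x| * (1 - `|s i|) <= M * (1 - `|s i|) by rewrite !mulrBr !mulr1; lra.
by rewrite ler_pM2r// subr_gt0.
Qed.

(** A word starting with [N] letters [i] sends the whole ball of radius [M + 1] close to [x], one
    starting with [N] letters [j] sends it close to [y]. *)
Lemma separated_words i j x y :
  ifs_map s t i x = x -> ifs_map s t j y = y -> x != y ->
  exists2 N, (0 < N)%N & forall z z', `|z| <= M + 1 -> `|z'| <= M + 1 ->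
    word_map (nseq N i ++ nseq N j) z <> word_map (nseq N j ++ nseq N i) z'.
Proof.
move=> fix_x fix_y xy.
have xM := fixed_point_bounded fix_x; have yM := fixed_point_bounded fix_y.
(* The factor 4 covers two images, each within [rho ^+ N * ((M + 1) *+ 2)] of its fixed point. *)
have cv : (rho ^+ N * ((M + 1) *+ 4)) @[N --> \oo] --> (0 : R).
  rewrite -[X in _ --> X](mul0r ((M + 1) *+ 4)); apply: cvgMl.
  by apply: cvg_expr; rewrite ger0_norm.
have d0 : 0 < `|x - y| by rewrite normr_gt0 subr_eq0.
have [N0 _ HN] : \forall N \near \oo, rho ^+ N * ((M + 1) *+ 4) < `|x - y|.
  exact: (cvgr_lt _ cv).
have {HN} := HN N0.+1 (leqnSn _); set N := N0.+1 => HN.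
exists N => // z z' zM z'M; rewrite /word_map !foldr_cat -!/(word_map _ _) => E.
have close i' x' w : ifs_map s t i' x' = x' -> `|w| <= M + 1 ->
    `|word_map (nseq N i') w - x'| <= rho ^+ N * ((M + 1) *+ 2).
  move=> fix_x' wM; rewrite word_map_fixed// normrM normrX ler_pM ?exprn_ge0//.
    by apply: lerXn2r => //; rewrite nnegrE.
  rewrite (le_trans (ler_normB _ _))// mulr2n lerD//.
  by rewrite (le_trans (fixed_point_bounded fix_x'))// lerDl.
have Hx := close _ _ _ fix_x (word_map_bounded (nseq N j) zM).
have Hy := close _ _ _ fix_y (word_map_bounded (nseq N i) z'M).
move: HN; apply/negP; rewrite -leNgt.
rewrite -(subrKA (word_map (nseq N i) (word_map (nseq N j) z))).
rewrite (le_trans (ler_normD _ _))// distrC {2}E.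
by rewrite (le_trans (lerD Hx Hy))// -mulrDr -mulrnDr.
Qed.

End words.

(** * Construction of the model from words of even length *)

Theorem theorem1p2 (R : realType) (n : nat) (s t p : 'I_n -> R)
  (mu : probability R R) (beta : R) :
  self_similar_IFS s t ->
  pos_prob_vector p ->
  self_similar_measure s t p mu ->
  non_atomic mu ->
  1 < beta ->
  exists (m : nat) (k : 'I_m.+1 -> nat) (r : 'I_m.+1 -> R)
         (tt : forall i : 'I_m.+1, 'I_(k i).+1 -> R)
         (pp : forall i : 'I_m.+1, 'I_(k i).+1 -> R)
         (P : probability (Omega m) R),
    (* Sigma is a model *)
    (forall i, r i != 0 /\ `|r i| < 1) /\
    (forall i, pos_prob_vector (pp i)) /\
    shift_invariant P /\
    (* Bernoulli *)
    bernoulli_measure P /\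
    (* strong separation condition *)
    strong_separation r tt /\
    (* for the product measures etabar^(omega) = prod_n p_(omega_n) : *)
    (forall etabar : forall w : Omega m, probability (Xinf (digits k w)) R,
       (forall w : Omega m,
          is_product_measure (fun j => pp (w j)) (etabar w)) ->
       (* non-trivial *)
       {ae P, forall w : Omega m, non_atomic (eta_meas r tt w (etabar w))} /\
       (* (1) mu = int eta^(omega) dP(omega) *)
       (forall A : set R, measurable A ->
          mu A = (\int[P]_w eta_meas r tt w (etabar w) A)%E)) /\
    (* (2) *)
    ((exists j, irrational (ln `|s j| / ln beta)) ->
     exists i, irrational (ln `|r i| / ln beta)).

Proof.
move=> [s_lt1 [_ [i [j [x [y [fix_x [fix_y xy]]]]]]]] [p_gt0 p1] mu_selfsim _ _.
pose rho := \big[Num.max/0]_i `|s i|.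
have s_rho i' : `|s i'| <= rho by exact: le_bigmax.
have rho1 : rho < 1 by apply: bigmax_lt => // i' _; have [] := s_lt1 i'.
have rho0 : 0 <= rho by exact: le_trans (s_rho i).
(* [M] solves [rho * M + \sum_i |t i| = M], so one radius serves all the maps. *)
pose M := (\sum_i `|t i|) / (1 - rho).
have M0 : 0 <= M by rewrite divr_ge0 ?sumr_ge0// subr_ge0 ltW.
have stM i' : `|s i'| * M + `|t i'| <= M.
  apply: (@le_trans _ _ (rho * M + \sum_i `|t i|)).
    rewrite lerD ?ler_wpM2r//; rewrite (bigD1 i')//= lerDl; exact: sumr_ge0.
  have : M * (1 - rho) = \sum_i `|t i| by rewrite divfK// gt_eqF// subr_gt0.
  by move=> <-; rewrite mulrBr mulr1 [rho * M]mulrC addrC subrK.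
have [N N0 sep] := separated_words rho0 rho1 s_rho stM fix_x fix_y xy.
pose a : (N + N).-tuple 'I_n := [tuple of nseq N i ++ nseq N j].
pose b : (N + N).-tuple 'I_n := [tuple of nseq N j ++ nseq N i].
have ab : a != b.
  apply/eqP => /(congr1 val)/= ab; have M1 : `|0 : R| <= M + 1 by rewrite normr0 addr_ge0.
  by apply: (sep 0 0 M1 M1); rewrite ab.
have sab : word_ratio s a = word_ratio s b by rewrite /word_ratio !big_cat /= mulrC.
(* A contraction has only one fixed point, so distinct fixed points come from distinct indices. *)
have ij : i != j.
  apply: contraNneq xy => ij; have [_ s1] := s_lt1 i.
  have E : (x - y) * (1 - s i) = 0.
    have -> : (x - y) * (1 - s i) =
      (x - ifs_map s t i x) - (y - ifs_map s t i y) by rewrite /ifs_map; ring.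
    by rewrite fix_x [in X in _ - X]ij fix_y !subrr.
  move/eqP: E; rewrite mulf_eq0 subr_eq0 => /orP[//|].
  by rewrite subr_eq0 => /eqP s1E; rewrite -s1E normr1 ltxx in s1.
(* The merging is applied to the IFS formed by all words of length [N + N]. *)
have := @merge_model R _ (fun l : (N + N).-tuple 'I_n => word_ratio s l)
  (fun l => word_map s t l 0) (fun l => \prod_(i <- l) p i) a b rho M mu.
case.
- by move=> l; apply: prodr_gt0.
- exact: (word_weight1 p_gt0 mu_selfsim).
- exact: rho0.
- exact: rho1.
- exact: M0.
- by move=> l; rewrite prodf_seq_neq0; apply/allP => i' _; have [] := s_lt1 i'.
- by move=> l; apply: word_ratio_le; rewrite ?size_tuple ?addn_gt0 ?N0.
- by move=> l; exact: word_bound.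
- exact: ab.
- exact: sab.
- by move=> z z' zM z'M; rewrite -!word_mapE; exact: sep.
- move=> A mA; rewrite (word_selfsim p_gt0 mu_selfsim (N + N) mA).
  apply: eq_bigr => l _; congr (_ * mu (_ @^-1` A))%E.
  by apply/funext => z; exact: word_mapE.
move=> m [k [r [tt [pp [P [H1 [H2 [H3 [H4 [H5 [H6 H7]]]]]]]]]]].
exists m, k, r, tt, pp, P; do 6 (split; first by []).
move=> [j0 irr_j0].
(* The constant word differs from [b], which contains both [i] and [j], so its ratio occurs among
   the [r i]. *)
have [|i0 r_i0] := H7 [tuple of nseq (N + N) j0].
  apply/eqP => /(congr1 val)/= E.
  have : i \in nseq (N + N) j0 by rewrite E mem_cat !mem_nseq eqxx N0 orbT.
  have : j \in nseq (N + N) j0 by rewrite E mem_cat !mem_nseq eqxx N0.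
  rewrite !mem_nseq => /andP[_ /eqP jj0] /andP[_ /eqP ij0].
  by rewrite ij0 jj0 eqxx in ij.
(* This ratio is [s j0 ^+ (N + N)], so its logarithm is a positive integer multiple of that of
   [s j0]. *)
exists i0; rewrite r_i0 /word_ratio/= big_nseq iter_mulr_1 normrX lnXn; last first.
  by rewrite normr_gt0; have [] := s_lt1 j0.
by rewrite mulrnAl; apply: irrationalMn => //; rewrite addn_gt0 N0.
Qed.
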